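(* For any $n$-dimensional infinite constellation $S$ with NLD $\delta$, transmitted over the real scalar fast fading channel described in the context, the average error probability satisfies $$P_e(S)\ge \Pr\left\{\|\mathbf z\|^2\ge e^{-2\delta}\left(\frac{\det(\mathbf H)}{V_n}\right)^{2/n}\right\},$$ where $V_n=\frac{\pi^{n/2}}{\frac n2\Gamma(\frac n2)}$ is the volume of the unit ball in $\mathbb R^n$, $\mathbf z\sim N(0,\sigma^2I_n)$ and $\mathbf H=\mathrm{diag}(H_1,\dots,H_n)$ are independent, and the probability is over both.
   Context: Channel: $Y_i=H_iX_i+Z_i$ where $\{H_i\}$ are i.i.d. nonnegative fading coefficients with $E H_i^2=1$ whose PDF is a regular fading distribution (there is $\alpha>0$ with $f(h)\propto h^{\alpha-1}$ for all small $h>0$; a standing assumption of the paper), $\{Z_i\}$ i.i.d. $N(0,\sigma^2)$, all independent, receiver knows $\mathbf H$. An IC is a countable $S\subset\mathbb R^n$; $\mathrm{Cb}(a)=\{|x_i|<a/2\}$; density $\gamma=\limsup_a|S\cap\mathrm{Cb}(a)|/a^n$; NLD $\delta=\frac1n\ln\gamma$. $P_e(S)=E\{\limsup_{a\to\infty}\frac{1}{M(S_{\mathbf H},a)}\sum_{s_{rc}\in S_{\mathbf H}\cap\mathbf H\mathrm{Cb}(a)}\Pr\{s_{rc}+\mathbf z\notin W(s_{rc})\mid\mathbf H\}\}$ where $S_{\mathbf H}=\{\mathbf Hs:s\in S\}$, $M(S_{\mathbf H},a)=|S_{\mathbf H}\cap\mathbf H\mathrm{Cb}(a)|$, and $W(s_{rc})$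 is the Voronoi cell of $s_{rc}$ in $S_{\mathbf H}$. *)

(* Defs.v *)
From HB Require Import structures.
From mathcomp Require Import all_boot all_order all_algebra.
From mathcomp Require Import finmap.
From mathcomp Require Import all_classical all_reals all_analysis.
Set Implicit Arguments. Unset Strict Implicit. Unset Printing Implicit Defensive.
Import Order.TTheory GRing.Theory Num.Theory.
Local Open Scope classical_set_scope.
Local Open Scope ring_scope.

Section Defs.
Variable R : realType.

Definition Gamma (x : R) : R :=
  fine (\int[@lebesgue_measure R]_(t in `]0%R, +oo[%classic) ((t `^ (x - 1)) * expR (- t))%:E)%E.

Definition Vball (n : nat) : R :=
  pi `^ (n%:R / 2) / ((n%:R / 2) * Gamma (n%:R / 2)).

Variable n : nat.

Definition sqnorm (x : 'rV[R]_n) : R := \sum_(i < n) (x 0 i) ^+ 2.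

Definition chan (h x : 'rV[R]_n) : 'rV[R]_n := x *m diag_mx h.

Definition cube (a : R) : set 'rV[R]_n := [set x | forall i, `|x 0 i| < a / 2].

Definition ecard (A : set 'rV[R]_n) : \bar R :=
  if pselect (finite_set A) then ((#|` fset_set A|%fset)%:R)%:E else +oo%E.

Definition limsup_pinfty (g : R -> \bar R) : \bar R :=
  ereal_inf [set ereal_sup [set g a | a in [set a | M < a]] | M in [set: R]].

Definition ic_density (S : set 'rV[R]_n) : \bar R :=
  limsup_pinfty (fun a => (ecard (S `&` cube a) * ((a ^+ n)^-1)%:E)%E).

Definition is_NLD (S : set 'rV[R]_n) (delta : R) : Prop :=
  exists g : R, 0 < g /\ ic_density S = g%:E /\ delta = ln g / n%:R.

Definition voronoi (C : set 'rV[R]_n) (y : 'rV[R]_n) : set 'rV[R]_n :=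
  [set x | forall y', C y' -> sqnorm (x - y) <= sqnorm (x - y')].

Variables (d : measure_display) (T : measurableType d) (P : probability T R).

Definition rvec (X : 'I_n -> T -> R) (t : T) : 'rV[R]_n := \row_i X i t.

(* given H = h: (1/M) sum_{y in S_h cap h Cb(a)} Pr{ y + z notin W(y) }
   (z independent of H, so the conditional probability given H = h is the
   unconditional probability over z) *)
Definition avg_err (Zs : 'I_n -> T -> R) (S : set 'rV[R]_n) (h : 'rV[R]_n) (a : R) : R :=
  let C := chan h @` S in
  let A := C `&` (chan h @` cube a) in
  (\sum_(y \in A) fine (P [set t | ~ voronoi C y (y + rvec Zs t)]))
    / (#|` fset_set A|%fset)%:R.

Definition Pe (Hs Zs : 'I_n -> T -> R) (S : set 'rV[R]_n) : \bar R :=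
  (\int[P]_t limsup_pinfty (fun a => (avg_err Zs S (rvec Hs t) a)%:E))%E.

Definition mutually_independent (I : finType) (X : I -> T -> R) : Prop :=
  forall B : I -> set R, (forall i, measurable (B i)) ->
    fine (P (\bigcap_(i in [set: I]) (X i @^-1` B i))) =
    \prod_(i : I) fine (P (X i @^-1` B i)).

Definition HZfamily (Hs Zs : 'I_n -> T -> R) (k : 'I_n + 'I_n) : T -> R :=
  match k with inl i => Hs i | inr i => Zs i end.

End Defs.

Definition regular_fading_pdf (R : realType) (f : R -> R) : Prop :=
  measurable_fun [set: R] f /\ (forall x, 0 <= f x) /\
  exists alpha c eps : R, [/\ 0 < alpha, 0 < c, 0 < eps &
    forall h, 0 < h < eps -> f h = c * h `^ (alpha - 1)].

(* Main.v *)
Require Import Defs.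
From HB Require Import structures.
From mathcomp Require Import all_boot all_order all_algebra.
From mathcomp Require Import finmap.
From mathcomp Require Import all_classical all_reals all_analysis.
From mathcomp Require Import measurable_realfun.
From mathcomp Require Import ring lra.
Set Implicit Arguments. Unset Strict Implicit. Unset Printing Implicit Defensive.
Import Order.TTheory GRing.Theory Num.Theory.
Import numFieldNormedType.Exports.
Local Open Scope classical_set_scope.
Local Open Scope ring_scope.

(* Fix the fading vector h > 0, let phi be the density of z, B the ball whose
   volume det(h) / gamma is the inverse density of the received constellation
   hS, and c the value of phi on its boundary sphere.  Since (phi - c)(1_U - 1_B)
   <= 0 pointwise, every measurable U satisfies
     Pr(z in U) <= Pr(z in B) + c (vol U - vol B),
   which replaces both the equivalent-sphere argument and Jensen's inequality.
   Apply it to the Voronoi cells of the points of hS in h Cb(a), truncated to a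
   fixed cube K so that they stay near h Cb(a).  Truncated cells are essentially
   disjoint, so their volumes add up to at most the volume of the slightly
   enlarged box h Cb(a) + K.  Along radii a at which |S cap Cb(a)| / a^n is close
   to gamma the volume terms cancel in the average; letting K grow gives
   limsup_a avg_err >= Pr(z notin B).  Integrate over h by independence.

   Lebesgue measure on R^n is the iterated product [prodm] on tuples; the volume
   of the unit ball is obtained from the Gaussian integral and Tonelli. *)

(** * Densities and one-dimensional changes of variables *)

Section Density.
Context d (T : measurableType d) (R : realType).
Variables (mu m : {measure set T -> \bar R}) (w : T -> R).
Hypotheses (mw : measurable_fun [set: T] w) (w0 : forall x, 0 <= w x).
Hypothesis m_density :
  forall A, measurable A -> m A = (\int[mu]_(x in A) (w x)%:E)%E.
Local Open Scope ereal_scope.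
Import HBNNSimple.

Let int_nnsfun (h : {nnsfun T >-> R}) :
  \int[m]_x (h x)%:E = \int[mu]_x ((h x)%:E * (w x)%:E).
Proof.
have mwE : measurable_fun [set: T] (fun x => (w x)%:E) by exact/measurable_EFinP.
transitivity (\sum_(k \in range h) k%:E * m (h @^-1` [set k])).
  by rewrite integralT_nnsfun sintegralE.
under [RHS]eq_integral do rewrite fimfunE -fsumEFin//.
transitivity (\int[mu]_x
    (\sum_(k \in range h) (k * \1_(h @^-1` [set k]) x)%:E * (w x)%:E)).
  rewrite ge0_integral_fsum//; last 2 first.
  - move=> k; apply: emeasurable_funM => //.
    by apply/measurable_EFinP/measurable_funM => //; exact: measurable_indic.
  - by move=> k x _; rewrite mule_ge0 ?nnfun_muleindic_ge0 ?lee_fin.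
  apply: eq_fsbigr => k _.
  rewrite m_density//.
  have [k0|k0] := leP 0%R k; last first.
    rewrite preimage_nnfun0//= integral_set0 mule0.
    by rewrite integral0_eq// => x _; rewrite indic0 mulr0 mul0e.
  rewrite -ge0_integralZl//; last 2 first.
  - exact: measurable_funTS.
  - by move=> x _; rewrite lee_fin.
  rewrite integral_mkcond; apply: eq_integral => x _.
  rewrite patchE indicE; case: ifPn => _; first by rewrite mulr1.
  by rewrite mulr0 mul0e.
apply: eq_integral => x _.
by rewrite ge0_mule_fsuml// => i; exact: nnfun_muleindic_ge0.
Qed.

(** The density hypothesis covers indicators, [int_nnsfun] extends it to simple functions, and
    monotone convergence along [nnsfun_approx] does the rest. *)
Lemma integral_density (f : T -> \bar R) : measurable_fun [set: T] f ->
  (forall x, 0 <= f x) -> \int[m]_x f x = \int[mu]_x (f x * (w x)%:E).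
Proof.
move=> mf f0.
have mwE : measurable_fun [set: T] (fun x => (w x)%:E) by exact/measurable_EFinP.
pose g := nnsfun_approx measurableT mf.
have gf x : EFin \o g^~ x @ \oo --> f x by exact: cvg_nnsfun_approx.
transitivity (limn (fun n => \int[m]_x (g n x)%:E)).
  rewrite -monotone_convergence//.
  - by apply: eq_integral => x _; apply/esym/cvg_lim => //; exact: gf.
  - by move=> n; exact/measurable_EFinP.
  - by move=> n x _; rewrite lee_fin.
  - by move=> x _ a b ab; rewrite lee_fin; exact/lefP/nd_nnsfun_approx.
transitivity (limn (fun n => \int[mu]_x ((g n x)%:E * (w x)%:E))).
  by congr (limn _); apply/funext => n; exact: int_nnsfun.
rewrite -monotone_convergence//.
- apply: eq_integral => x _; apply/cvg_lim => //.
  by apply: cvgeZr => //; exact: gf.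
- by move=> n; apply: emeasurable_funM => //; exact/measurable_EFinP.
- by move=> n x _; rewrite mule_ge0 ?lee_fin.
- move=> x _ a b ab; rewrite lee_wpmul2r ?lee_fin//.
  exact/lefP/nd_nnsfun_approx.
Qed.

End Density.

Section Pushforward.
Context d d' (T1 : measurableType d) (T2 : measurableType d') (R : realType).
Variables (m : {measure set T1 -> \bar R}) (f : T1 -> T2).

(** A wrapper around [pushforward] that carries the measurability proof, so that the measure
    structure can be inferred from the term. *)
Definition pushm of measurable_fun [set: T1] f := pushforward m f.

Variable mf : measurable_fun [set: T1] f.

Let pushm0 : pushm mf set0 = 0%E.
Proof. by rewrite /pushm /pushforward preimage_set0 measure0. Qed.

Let pushm_ge0 A : (0 <= pushm mf A)%E.
Proof. exact: measure_ge0. Qed.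

Let pushm_sigma_additive : semi_sigma_additive (pushm mf).
Proof.
move=> F mF tF mUF; rewrite /pushm /pushforward preimage_bigcup.
apply: measure_semi_sigma_additive.
- by move=> n; rewrite -[X in measurable X]setTI; exact: mf.
- apply/trivIsetP => /= i j _ _ ij; rewrite -preimage_setI.
  by move/trivIsetP : tF => /(_ _ _ _ _ ij) ->//; rewrite preimage_set0.
- by rewrite -preimage_bigcup -[X in measurable X]setTI; exact: mf.
Qed.

HB.instance Definition _ := isMeasure.Build _ _ _ (pushm mf)
  pushm0 pushm_ge0 pushm_sigma_additive.

Lemma ge0_integral_pushm (g : T2 -> \bar R) : measurable_fun [set: T2] g ->
  (forall y, 0 <= g y)%E -> (\int[pushm mf]_y g y = \int[m]_x g (f x))%E.
Proof.
by move=> mg g0; rewrite ge0_integral_pushforward// => y _; exact: g0.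
Qed.

End Pushforward.

Section Affine1.
Context {R : realType}.
Local Notation leb := (@lebesgue_measure R).
Local Open Scope ereal_scope.

(** Lebesgue measure is c times its image under x -> c x + a, because the two agree on half-open
    intervals. *)
Lemma ge0_integral_affine (c a : R) (f : measurableTypeR R -> \bar R) : (0 < c)%R ->
  measurable_fun [set: measurableTypeR R] f -> (forall x, 0 <= f x) ->
  \int[leb]_x f (c * x + a)%R = (c^-1)%:E * \int[leb]_x f x.
Proof.
move=> c0 mf f0.
pose p : measurableTypeR R -> measurableTypeR R := fun x => (c * x + a)%R.
have mp : measurable_fun [set: measurableTypeR R] p.
  by apply: measurable_funD => //; exact: measurable_funM.
have cE A : measurable A -> leb A = mscale (NngNum (ltW c0)) (pushm leb mp) A.
  move=> mA; apply: lebesgue_measure_unique => // _ [[x y] _ <-].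
  rewrite /= /mscale /pushm /pushforward/=.
  rewrite (_ : p @^-1` _ = `](x - a) / c, (y - a) / c]%classic)%R; last first.
    apply/seteqP; split => z/=; rewrite !in_itv/= /p;
    by rewrite ltr_pdivrMr// ler_pdivlMr// ltrBlDr lerBrDr (mulrC z).
  rewrite !lebesgue_measure_itv/= !lte_fin ltr_pM2r ?invr_gt0// ltrD2r.
  case: ifPn => _; last by rewrite mule0.
  rewrite -!EFinB -EFinM; congr EFin; field; exact/lt0r_neq0.
rewrite [in RHS](eq_measure_integral (mscale (NngNum (ltW c0)) (pushm leb mp))); last first.
  by move=> A mA _; exact: cE.
rewrite ge0_integral_mscale// ge0_integral_pushm// muleA -EFinM mulVf ?mul1e//.
exact/lt0r_neq0.
Qed.

Lemma integral_normal_prob (m s : R) (f : measurableTypeR R -> \bar R) :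
  measurable_fun [set: measurableTypeR R] f -> (forall x, 0 <= f x) ->
  \int[normal_prob m s]_x f x = \int[leb]_x (f x * (normal_pdf m s x)%:E).
Proof.
move=> mf f0; apply: integral_density => //.
- exact: measurable_normal_pdf.
- exact: normal_pdf_ge0.
Qed.

End Affine1.

(** * Product measures on tuples *)

Section ProdM.
Context d (T : measurableType d) (R : realType).
Variable m : {sigma_finite_measure set T -> \bar R}.
Local Open Scope ereal_scope.

Definition tcons n (p : T * n.-tuple T) : n.+1.-tuple T := [tuple of p.1 :: p.2].

Lemma measurable_tcons n : measurable_fun [set: T * n.-tuple T] (@tcons n).
Proof. exact: measurable_cons. Qed.

Section step.
Variables (n : nat) (mu : {sigma_finite_measure set (n.-tuple T) -> \bar R}).

Definition prodmS := pushm (m \x mu)%E (@measurable_tcons n).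

HB.instance Definition _ := Measure.on prodmS.

Let prodmS_sigma_finite : sigma_finite [set: n.+1.-tuple T] prodmS.
Proof.
have /sigma_finiteP[F [TF ndF Foo]] := sigma_finiteT m.
have /sigma_finiteP[G [TG ndG Goo]] := sigma_finiteT mu.
(* Splitting into head and tail is a measurable left inverse of [tcons]; it transports the
   exhausting rectangles F k x G k to tuples. *)
pose q (v : n.+1.-tuple T) := (tnth v ord0, [tuple of behead v]).
have mq : measurable_fun setT q.
  by apply/measurable_fun_pairP; split => /=;
    [exact: measurable_tnth|exact: measurable_behead].
have qK : cancel (@tcons n) q.
  by move=> [x v]; congr pair; apply/val_inj.
have mFG k : measurable (F k `*` G k).
  by apply: measurableX; [case: (Foo k)|case: (Goo k)].
exists (fun k => q @^-1` (F k `*` G k)).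
  rewrite -preimage_bigcup -[LHS](preimage_setT q); congr (_ @^-1` _).
  apply/seteqP; split => // -[x v] _.
  have : (\bigcup_k F k) x by rewrite -TF.
  have : (\bigcup_k G k) v by rewrite -TG.
  move=> [j _ Gv] [i _ Fx]; exists (maxn i j) => //; split => /=.
    by move: x Fx; exact/subsetPset/ndF/leq_maxl.
  by move: v Gv; exact/subsetPset/ndG/leq_maxr.
move=> k; split; first by rewrite -[X in measurable X]setTI; exact: mq.
rewrite /prodmS /pushm /pushforward -comp_preimage.
rewrite (_ : q \o _ = id) ?preimage_id; last by apply/funext => p /=; rewrite qK.
have [? ?] := Foo k; have [? ?] := Goo k.
rewrite [ltLHS](_ : _ = m (F k) * mu (G k)); last exact: product_measure1E.
by rewrite lte_mul_pinfty// ge0_fin_numE.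
Qed.

HB.instance Definition _ :=
  Measure_isSigmaFinite.Build _ _ _ prodmS prodmS_sigma_finite.
End step.

(** The recursion returns a sigma-finite measure because Tonelli at the next step requires one. The
    empty product is the Dirac mass at the empty tuple. *)
Fixpoint prodm n : {sigma_finite_measure set (n.-tuple T) -> \bar R} :=
  match n with
  | 0%N => \d_([tuple])
  | n'.+1 => prodmS (prodm n')
  end.

Lemma integral_prodm0 (F : 0.-tuple T -> \bar R) : measurable_fun setT F ->
  \int[prodm 0]_v F v = F [tuple].
Proof. by move=> mF; rewrite integral_dirac// diracT mul1e. Qed.

Lemma integral_prodmS n (F : n.+1.-tuple T -> \bar R) :
  measurable_fun setT F -> (forall v, 0 <= F v) ->
  \int[prodm n.+1]_v F v = \int[m]_x \int[prodm n]_v F [tuple of x :: v].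
Proof.
move=> mF F0; rewrite /= /prodmS ge0_integral_pushm//.
rewrite fubini_tonelli1//.
by apply: measurableT_comp => //; exact: measurable_tcons.
Qed.

Lemma measurable_fun_slice n (F : n.+1.-tuple T -> \bar R) x :
  measurable_fun setT F -> measurable_fun setT (fun v : n.-tuple T => F [tuple of x :: v]).
Proof.
move=> mF; apply: (measurableT_comp mF).
apply: (@measurable_cons _ _ _ _ (cst x) n id) => //.
Qed.

Lemma measurable_integral_slice n (F : n.+1.-tuple T -> \bar R) :
  measurable_fun setT F -> (forall v, 0 <= F v) ->
  measurable_fun setT (fun x => \int[prodm n]_v F [tuple of x :: v]).
Proof.
move=> mF F0.
apply: (@measurable_fun_fubini_tonelli_F _ _ _ _ _ (prodm n) (F \o @tcons n)).
  by apply: measurableT_comp => //; exact: measurable_tcons.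
by move=> p; exact: F0.
Qed.

Definition box n (B : 'I_n -> set T) : set (n.-tuple T) :=
  [set v | forall i, B i (tnth v i)].

Lemma measurable_box n (B : 'I_n -> set T) : (forall i, measurable (B i)) ->
  measurable (box B).
Proof.
move=> mB; rewrite (_ : box B = \bigcap_(i in [set: 'I_n]) ((@tnth n T)^~ i @^-1` B i)).
  apply: fin_bigcap_measurable => // i _.
  by rewrite -[X in measurable X]setTI; exact: measurable_tnth.
by apply/seteqP; split => v /= h; [move=> i _; exact: h|move=> i; exact: (h i)].
Qed.

Lemma integral_prodm_prod n (g : 'I_n -> T -> R) :
  (forall i, measurable_fun setT (g i)) -> (forall i x, (0 <= g i x)%R) ->
  \int[prodm n]_v (\prod_(i < n) g i (tnth v i))%:E =
  \prod_(i < n) \int[m]_x (g i x)%:E.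
Proof.
elim: n g => [|n IH] g mg g0.
  rewrite integral_prodm0 ?big_ord0//.
  by rewrite (_ : (fun _ => _) = cst 1%E)//; apply/funext => v; rewrite big_ord0.
have mF k (h : 'I_k -> T -> R) : (forall i, measurable_fun setT (h i)) ->
    measurable_fun [set: k.-tuple T] (fun v => (\prod_(i < k) h i (tnth v i))%:E).
  move=> mh; apply/measurable_EFinP; apply: measurable_prod => i _.
  by apply: measurableT_comp (mh i) _; exact: measurable_tnth.
rewrite integral_prodmS; [|exact: mF|by move=> v; rewrite lee_fin prodr_ge0].
transitivity (\int[m]_x ((g ord0 x)%:E *
    \int[prodm n]_v (\prod_(i < n) g (lift ord0 i) (tnth v i))%:E)).
  apply: eq_integral => x _.
  rewrite -ge0_integralZl//; last 3 first.
  - by apply: (mF _ (fun i => g (lift ord0 i))) => i; exact: mg.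
  - by move=> v _; rewrite lee_fin prodr_ge0.
  - by rewrite lee_fin.
  apply: eq_integral => v _; rewrite big_ord_recl -EFinM tnth0; congr (_ * _)%:E.
  by apply: eq_bigr => i _; rewrite tnthS.
rewrite big_ord_recl -IH// ge0_integralZr//.
- exact/measurable_EFinP.
- by move=> x _; rewrite lee_fin.
- by apply: integral_ge0 => v _; rewrite lee_fin prodr_ge0.
Qed.

(** The indicator of a box is a product of coordinate indicators, to which [integral_prodm_prod]
    applies. *)
Lemma prodm_box n (B : 'I_n -> set T) : (forall i, measurable (B i)) ->
  prodm n (box B) = \prod_(i < n) m (B i).
Proof.
move=> mB; rewrite -[LHS]mul1e -[LHS]integral_cst; last exact: measurable_box.
rewrite integral_mkcond.
transitivity (\int[prodm n]_v (\prod_(i < n) (\1_(B i) (tnth v i) : R))%:E).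
  apply: eq_integral => v _; rewrite patchE.
  case: ifPn => [/[!inE] vB|/negP vB].
    rewrite big1// => i _; rewrite indicE mem_set//; exact: vB.
  have [i iB] : exists i, ~ B i (tnth v i).
    by apply/existsNP => h; apply: vB; rewrite inE.
  by rewrite (bigD1 i)//= indicE memNset// mul0r.
rewrite (integral_prodm_prod (g := fun i => \1_(B i)))//.
- by apply: eq_bigr => i _; rewrite integral_indic// setIT.
Qed.

End ProdM.

Section Uniqueness.
Context d (T : measurableType d) (R : realType) (n : nat).

(* Boxes form a pi-system that generates the sigma-algebra of tuples. *)
Lemma tuple_measure_unique (m1 m2 : {measure set (n.-tuple T) -> \bar R}) :
  (forall B : 'I_n -> set T, (forall i, measurable (B i)) ->
    m1 (box B) = m2 (box B)) ->
  (m1 setT < +oo)%E -> forall A, measurable A -> m1 A = m2 A.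
Proof.
move=> m12 fin A mA.
pose G := [set X | exists2 B : 'I_n -> set T, (forall i, measurable (B i)) & X = box B].
have GT : G setT.
  by exists (fun=> setT) => //; apply/seteqP; split.
apply: (measure_unique G (fun=> setT)) => //.
- apply/seteqP; split; last first.
    apply: smallest_sub; first exact: sigma_algebra_measurable.
    by move=> _ [B mB ->]; exact: measurable_box.
  apply: smallest_sub; first exact: smallest_sigma_algebra.
  rewrite -bigcup_seq => X [i _ [Y mY <-]]; apply: sub_sigma_algebra.
  (* A generator of the sigma-algebra constrains a single coordinate: it is a box whose other sides
     are full. *)
  exists (fun j => if j == i then Y else setT).
    by move=> j; case: ifP.
  apply/seteqP; split => v /=.
    by move=> [_ vY] j; case: eqP => // ->.
  by move/(_ i); rewrite eqxx.
- move=> _ _ [B mB ->] [C mC ->]; exists (fun i => B i `&` C i).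
    by move=> i; exact: measurableI.
  by apply/seteqP; split => v /= h; [move=> i; split; apply h|split => i; apply h].
- by rewrite bigcup_const//; exists 0%N.
- by move=> _ [B mB ->]; exact: m12.
Qed.

End Uniqueness.

Section ProdDensity.
Context d (T : measurableType d) (R : realType).
Variables (m mu : {sigma_finite_measure set T -> \bar R}) (w : T -> R).
Hypotheses (mw : measurable_fun [set: T] w) (w0 : forall x, 0 <= w x).
Local Open Scope ereal_scope.
Hypothesis int_density : forall f : T -> \bar R, measurable_fun [set: T] f ->
  (forall x, 0 <= f x) -> \int[m]_x f x = \int[mu]_x (f x * (w x)%:E).

Lemma measurable_prod_tnth n :
  measurable_fun [set: n.-tuple T] (fun v => (\prod_(i < n) w (tnth v i))%R).
Proof.
apply: measurable_prod => i _.
by apply: measurableT_comp mw _; exact: measurable_tnth.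
Qed.

(** Tonelli peels off one coordinate at a time, and each one-dimensional change of measure
    contributes one factor [w]. *)
Lemma integral_prodm_density n (F : n.-tuple T -> \bar R) :
  measurable_fun [set: n.-tuple T] F -> (forall v, 0 <= F v) ->
  \int[prodm m n]_v F v =
  \int[prodm mu n]_v (F v * (\prod_(i < n) w (tnth v i))%:E).
Proof.
have mW k : measurable_fun [set: k.-tuple T]
    (fun v => (\prod_(i < k) w (tnth v i))%:E).
  by apply/measurable_EFinP; exact: measurable_prod_tnth.
have W0 k (v : k.-tuple T) : 0 <= (\prod_(i < k) w (tnth v i))%:E.
  by rewrite lee_fin prodr_ge0.
elim: n F => [|n IH] F mF F0.
  rewrite !integral_prodm0 ?big_ord0 ?mule1//.
  by apply: emeasurable_funM => //; exact: mW.
rewrite !integral_prodmS//; first last.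
- by move=> v; exact: mule_ge0.
- by apply: emeasurable_funM => //; exact: mW.
rewrite int_density; [|exact: measurable_integral_slice|by move=> x; exact: integral_ge0].
apply: eq_integral => x _; rewrite IH//; last exact: measurable_fun_slice.
rewrite -ge0_integralZr//; last 3 first.
- by apply: emeasurable_funM; [exact: measurable_fun_slice|exact: mW].
- by move=> v _; exact: mule_ge0.
- by rewrite lee_fin.
apply: eq_integral => v _; rewrite -muleA -EFinM; congr (_ * _%:E).
rewrite big_ord_recl tnth0 mulrC; congr (_ * _)%R.
by apply: eq_bigr => i _; rewrite tnthS.
Qed.

End ProdDensity.

(** * Scaling and translation of Lebesgue measure on tuples *)

Section Lam.
Context {R : realType}.
Local Notation Rm := (measurableTypeR R).
Local Notation leb := (@lebesgue_measure R).
Local Notation lam := (prodm leb).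
Local Open Scope ereal_scope.

Definition taff n (c : R) (a : 'I_n -> R) (v : n.-tuple Rm) : n.-tuple Rm :=
  [tuple (c * tnth v i + a i)%R | i < n].

Lemma measurable_taff n c (a : 'I_n -> R) : measurable_fun setT (taff c a).
Proof.
apply/measurable_fun_tnthP => i; rewrite (_ : _ \o _ = fun v : n.-tuple Rm =>
    (c * (tnth v i : R) + a i)%R : R); last first.
  by apply/funext => v /=; rewrite tnth_mktuple.
apply: measurable_funD => //; apply: measurable_funM => //.
exact: (@measurable_tnth _ Rm n i).
Qed.

(** By induction on n, [ge0_integral_affine] contributes a factor 1/c for each coordinate, whatever
    the shift. *)
Lemma integral_taff n c (a : 'I_n -> R) (F : n.-tuple Rm -> \bar R) : (0 < c)%R ->
  measurable_fun setT F -> (forall v, 0 <= F v) ->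
  \int[lam n]_v F (taff c a v) = ((c ^+ n)^-1)%:E * \int[lam n]_v F v.
Proof.
move=> c0; elim: n a F => [|n IH] a F mF F0.
  rewrite !integral_prodm0//; last first.
    by apply: measurableT_comp => //; exact: measurable_taff.
  by rewrite expr0 invr1 mul1e (tuple0 (taff _ _ _)).
rewrite !integral_prodmS//; last first.
  by apply: measurableT_comp => //; exact: measurable_taff.
transitivity (\int[leb]_x ((c ^+ n)^-1%:E *
    \int[lam n]_v F [tuple of (c * x + a ord0)%R :: v])).
  apply: eq_integral => x _.
  rewrite -(IH (fun i => a (lift ord0 i))
     (fun v => F [tuple of (c * x + a ord0)%R :: v]))//; last first.
    exact: measurable_fun_slice.
  apply: eq_integral => v _; congr F; apply: eq_from_tnth => i.
  rewrite tnth_mktuple; case: (unliftP ord0 i) => [j|] ->.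
    by rewrite !tnthS tnth_mktuple.
  by rewrite !tnth0.
rewrite ge0_integralZl//; last 3 first.
- apply: (measurableT_comp (measurable_integral_slice _ mF F0)).
  by apply: measurable_funD => //; exact: measurable_funM.
- by move=> x _; exact: integral_ge0.
- by rewrite lee_fin invr_ge0 exprn_ge0// ltW.
rewrite (@ge0_integral_affine R c (a ord0)
  (fun x => \int[lam n]_v F [tuple of x :: v]) c0)//; last 2 first.
- exact: measurable_integral_slice.
- by move=> x; exact: integral_ge0.
by rewrite muleA -EFinM -invfM exprSr mulrC.
Qed.

Lemma prodm_taff n c (a : 'I_n -> R) (A : set (n.-tuple Rm)) : (0 < c)%R ->
  measurable A -> lam n (taff c a @^-1` A) = (c ^+ n)^-1%:E * lam n A.
Proof.
move=> c0 mA.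
have mtA : measurable (taff c a @^-1` A).
  by rewrite -[X in measurable X]setTI; exact: measurable_taff.
have := @integral_taff n c a (fun v => (\1_A v)%:E) c0.
rewrite [X in _ -> _ -> _ = _ * X]integral_indic// setIT => <-.
- by rewrite -[LHS]mul1e -integral_cst// integral_mkcond; apply: eq_integral => v _;
    rewrite patchE indicE; case: ifPn => [/set_mem h|/negP h]; [rewrite mem_set|rewrite memNset// => ?; apply: h; rewrite inE].
- by apply/measurable_EFinP; exact: measurable_indic.
- by move=> v; rewrite lee_fin.
Qed.

End Lam.

(** * The Gamma function and the volume of the ball *)

Section GammaFunction.
Context {R : realType}.
Local Notation leb := (@lebesgue_measure R).

Lemma integral_expR_tail (t : R) :
  (\int[leb]_(u in `]t, +oo[) (expR (- u))%:E = (expR (- t))%:E)%E.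
Proof.
have cE : continuous (fun x : R => expR (- x)).
  by move=> x; apply: continuous_comp; [exact: opp_continuous|exact: continuous_expR].
rewrite integral_itv_obnd_cbnd; last first.
  by apply/measurable_funTS/measurable_EFinP; exact: continuous_measurable_fun.
have dE (x : R) : is_derive x 1 (fun x : R => - expR (- x)) (expR (- x)).
  apply: is_derive_eq.
  by rewrite mulrN1 opprK.
rewrite (@ge0_continuous_FTC2y _ _ (fun x => - expR (- x)) t 0).
- by rewrite EFinN oppeK add0e.
- by move=> x _; exact: expR_ge0.
- exact: continuous_subspaceT.
- by rewrite -oppr0; apply: cvgN; exact: cvgr_expR.
- by move=> x _; apply: ex_derive.
- apply: cvg_at_right_filter; apply: (@cvgN _ R^o); exact: cE.
- by move=> x _; rewrite derive1E; exact: derive_val.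
Qed.

(** For x < 1 the integrand blows up at 0, so the fundamental theorem of calculus is applied on
    [a k, u] and monotone convergence lets a k tend to 0. *)
Lemma integral_powR (x u : R) : 0 < x -> 0 < u ->
  (\int[leb]_(t in `]0%R, u[) (x * t `^ (x - 1))%:E = (u `^ x)%:E)%E.
Proof.
move=> x0 u0.
have mf : measurable_fun [set: R] (fun t => (x * t `^ (x - 1))%:E).
  by apply/measurable_EFinP/measurable_funM => //; exact: measurable_powR.
(* The offset 2 makes a k strictly less than u already at k = 0. *)
pose a k : R := u / k.+2%:R.
have a0 k : 0 < a k by rewrite divr_gt0.
have au k : a k < u by rewrite ltr_pdivrMr// ltr_pMr// ltr1n.
have dP (y : R) : 0 < y -> derivable (@powR R ^~ x) y 1.
  by move=> y0; apply: derivable_powR; rewrite in_itv/= y0.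
have contP p (y : R) : 0 < y -> {for y, continuous (@powR R ^~ p)}.
  move=> y0; apply/differentiable_continuous/derivable1_diffP.
  by apply: derivable_powR; rewrite in_itv/= y0.
have Ik k : (\int[leb]_(t in `[a k, u]) (x * t `^ (x - 1))%:E =
    (u `^ x - a k `^ x)%:E)%E.
  rewrite (@continuous_FTC2 _ _ (@powR R ^~ x)).
  - by rewrite EFinB.
  - exact: au.
  - apply: continuous_in_subspaceT => y; rewrite inE/= in_itv/= => /andP[ay _].
    apply: (@continuousM _ R (cst x) (@powR R ^~ (x - 1)) y); first exact: cst_continuous.
    by apply: contP; exact: lt_le_trans (a0 k) ay.
  - split.
    + by move=> y; rewrite in_itv/= => /andP[ay _]; apply: dP; exact: lt_trans ay.
    + by apply: cvg_at_right_filter; exact: contP.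
    + by apply: cvg_at_left_filter; exact: contP.
  - move=> y; rewrite in_itv/= => /andP[ay _]; rewrite powR_derive1// in_itv/= andbT.
    exact: lt_trans ay.
have a_cvg : a k @[k --> \oo] --> 0.
  rewrite -(mulr0 u); apply: (@cvgMl_tmp _ _ _ _ (fun k => harmonic k.+1)).
  by rewrite (cvg_shiftS (@harmonic R)); exact: cvg_harmonic.
have a_cvg' : (u `^ x - a k `^ x)%:E @[k --> \oo] --> (u `^ x)%:E.
  apply: cvg_EFin; first by near=> k.
  rewrite -[X in _ --> X]subr0; apply: cvgB; first exact: cvg_cst.
  have := powR_cvg0 x0.
  move/cvg_at_rightP/(_ a); apply; split => //.
have -> : `]0, u[%classic = `]0, u]%classic `\ u.
  by rewrite setDitv1r.
rewrite integral_setD1; [|exact: measurableD|exact/measurable_funTS].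
have UE : \bigcup_k `[a k, u]%classic = `]0, u]%classic.
  apply/seteqP; split => [y [k _]/=|y/=]; rewrite !in_itv/=.
    by move=> /andP[ay ->]; rewrite andbT; exact: lt_le_trans ay.
  move=> /andP[y0 yu].
  have [k _ /(_ k (leqnn k)) ak] : \forall k \near \oo, a k < y.
    by move/cvgrPdist_lt : a_cvg => /(_ y y0); apply: filterS => k;
      rewrite sub0r normrN gtr0_norm.
  by exists k => //=; rewrite in_itv/= (ltW ak).
rewrite -UE; apply/esym; apply: (cvg_unique _ a_cvg') => //.
rewrite /= (_ : (fun k => (u `^ x - a k `^ x)%:E) =
  (fun k => \int[leb]_(t in `[a k, u]) (x * t `^ (x - 1))%:E)%E); last first.
  by apply/funext => k; rewrite Ik.
apply: ge0_nondecreasing_set_cvg_integral => //.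
- apply/nondecreasing_seqP => k; apply/subsetPset => y/=; rewrite !in_itv/=.
  move=> /andP[ay ->]; rewrite andbT (le_trans _ ay)//.
  by rewrite ler_pM2l// lef_pV2 ?posrE// ler_nat.
- by move=> k; exact/measurable_funTS.
- by move=> k y _; rewrite lee_fin mulr_ge0 ?powR_ge0// ltW.
Unshelve. all: by end_near. Qed.

Local Notation gammaE x :=
  (\int[leb]_(t in `]0%R, +oo[) (t `^ (x - 1) * expR (- t))%:E)%E.

(* Both sides are the integral of [x t^(x-1) e^-u] over [0 < t < u]. *)
Lemma gamma_recursion (x : R) : 0 < x ->
  (x%:E * gammaE x = \int[leb]_(u in `]0%R, +oo[) (u `^ x * expR (- u))%:E)%E.
Proof.
move=> x0.
pose D : set (measurableTypeR R * measurableTypeR R) := [set p | 0 < p.1 < p.2].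
have mD : measurable D.
  rewrite (_ : D = [set p | 0 < p.1] `&` [set p | p.1 < p.2]); last first.
    by apply/seteqP; split => -[a b]/=; rewrite /D/= => /andP.
  apply: measurableI.
    rewrite -[X in measurable X]setTI.
    by apply: (measurable_fun_ltr (f := cst 0) (g := fst)).
  rewrite -[X in measurable X]setTI.
  by apply: (measurable_fun_ltr (f := fst) (g := snd)).
have mpow : measurable_fun [set: measurableTypeR R] (fun t : R => x * t `^ (x - 1)).
  by apply: measurable_funM => //; exact: measurable_powR.
have mexp : measurable_fun [set: measurableTypeR R] (fun t : R => expR (- t)).
  exact: measurableT_comp.
pose h (p : measurableTypeR R * measurableTypeR R) : \bar R :=
  ((x * p.1 `^ (x - 1)) * expR (- p.2) * \1_D p)%:E.
have mh : measurable_fun setT h.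
  apply/measurable_EFinP; apply: measurable_funM; last exact: measurable_indic.
  apply: measurable_funM; first exact: (measurableT_comp mpow).
  exact: (measurableT_comp mexp).
have h0 p : (0 <= h p)%E.
  by rewrite lee_fin !mulr_ge0 ?powR_ge0 ?expR_ge0// ltW.
have := @fubini_tonelli _ _ _ _ R leb leb h mh h0.
(* With u innermost, the tail integral of e^-u over u > t is e^-t, which produces the Gamma
   integrand at x. *)
have -> : (\int[leb]_t \int[leb]_u h (t, u) = x%:E * gammaE x)%E.
  rewrite -ge0_integralZl//; last 3 first.
  - exact/measurable_funTS/measurable_EFinP/measurable_funM.
  - by move=> t _; rewrite lee_fin mulr_ge0 ?powR_ge0 ?expR_ge0.
  - by rewrite lee_fin ltW.
  rewrite [RHS]integral_mkcond; apply: eq_integral => t _.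
  rewrite patchE mem_setE in_itv/= andbT; case: ifPn => t0; last first.
    by apply: integral0_eq => u _; rewrite /h indicE memNset ?mulr0// /D/= (negbTE t0).
  transitivity (\int[leb]_(u in `]t, +oo[)
      ((x * t `^ (x - 1))%:E * (expR (- u))%:E))%E.
    rewrite [RHS]integral_mkcond; apply: eq_integral => u _.
    rewrite patchE mem_setE in_itv/= andbT /h indicE /=; case: ifPn => tu.
      by rewrite mem_set ?mulr1 ?EFinM// /D/= t0.
    by rewrite memNset ?mulr0// /D/= (negbTE tu) andbF.
  rewrite ge0_integralZl//; last 2 first.
  - exact/measurable_funTS/measurable_EFinP.
  - by rewrite lee_fin mulr_ge0 ?powR_ge0// ltW.
  by rewrite integral_expR_tail -!EFinM mulrA.
move=> ->; rewrite [RHS]integral_mkcond; apply: eq_integral => u _.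
rewrite patchE mem_setE in_itv/= andbT; case: ifPn => u0; last first.
  apply: integral0_eq => t _; rewrite /h indicE memNset ?mulr0// /D/=.
  by move=> /andP[t0 tu]; move: u0; rewrite (lt_trans t0 tu).
transitivity (\int[leb]_(t in `]0%R, u[)
    ((x * t `^ (x - 1))%:E * (expR (- u))%:E))%E.
  rewrite [RHS]integral_mkcond; apply: eq_integral => t _.
  rewrite patchE mem_setE in_itv/= /h indicE /=; case: ifPn => tu.
    by rewrite mem_set ?mulr1 ?EFinM.
  by rewrite memNset ?mulr0// /D/=; exact/negP.
rewrite ge0_integralZr//; last 2 first.
- exact/measurable_funTS/measurable_EFinP.
- by move=> t _; rewrite lee_fin mulr_ge0 ?powR_ge0// ltW.
by rewrite integral_powR// -EFinM.
Qed.

End GammaFunction.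

Section BallVolume.
Context {R : realType}.
Local Notation Rm := (measurableTypeR R).
Local Notation leb := (@lebesgue_measure R).
Local Notation lam := (prodm leb).

Definition tsq n (v : n.-tuple Rm) : R := \sum_(i < n) (tnth v i : R) ^+ 2.

(** [rho] is the squared radius, as in the threshold on |z|^2. The ball is open, so that its
    complement is exactly the event [rho <= tsq v]. *)
Definition tball n (rho : R) : set (n.-tuple Rm) := [set v | tsq v < rho].

Arguments tball : clear implicits.

Lemma tsq_ge0 n (v : n.-tuple Rm) : 0 <= tsq v.
Proof. by apply: sumr_ge0 => i _; exact: sqr_ge0. Qed.

Lemma measurable_tsq n : measurable_fun setT (@tsq n).
Proof.
apply: measurable_sum => i; apply: (measurable_funX 2).
exact: (@measurable_tnth _ Rm n i).
Qed.

Lemma measurable_tball n rho : measurable (tball n rho).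
Proof.
rewrite (_ : tball n rho = @tsq n @^-1` `]-oo, rho[%classic); last first.
  by apply/seteqP; split => v; rewrite /= in_itv.
by rewrite -[X in measurable X]setTI; exact: measurable_tsq.
Qed.

(** The unit ball pulls back to this ball under division by sqrt rho, and [prodm_taff] gives the
    Jacobian. *)
Lemma lam_tball n (rho : R) : 0 < rho ->
  lam n (tball n rho) = ((Num.sqrt rho ^+ n)%:E * lam n (tball n 1))%E.
Proof.
move=> rho0; have s0 : 0 < Num.sqrt rho by rewrite sqrtr_gt0.
have c0 : 0 < (Num.sqrt rho)^-1 by rewrite invr_gt0.
have := prodm_taff (fun=> 0) c0 (@measurable_tball n 1).
rewrite exprVn invrK => <-; congr (lam n _).
apply/seteqP; split => v /=;
by rewrite /tball/= (_ : tsq (taff _ _ _) = tsq v / rho) ?ltr_pdivrMr ?mul1r//;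
  rewrite /tsq mulr_suml; apply: eq_bigr => i _;
  rewrite tnth_mktuple addr0 exprMn exprVn sqr_sqrtr ?(ltW rho0)// mulrC.
Qed.

(* Tonelli for [e^-u] over [|v|^2 < u]. *)
Lemma gauss_layer_cake n : (0 < n)%N ->
  ((Num.sqrt pi ^+ n)%:E = lam n (tball n 1) * ((n%:R / 2)%:E *
    \int[leb]_(t in `]0%R, +oo[) (t `^ (n%:R / 2 - 1) * expR (- t))%:E))%E.
Proof.
move=> n0; have x0 : 0 < n%:R / 2 :> R by rewrite divr_gt0// ltr0n.
rewrite gamma_recursion//.
have mexp : measurable_fun [set: Rm] (fun t : R => expR (- t)).
  exact: measurableT_comp.
pose D : set (n.-tuple Rm * Rm) := [set p | tsq p.1 < p.2].
have mD : measurable D.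
  rewrite -[X in measurable X]setTI.
  apply: (measurable_fun_ltr (f := (@tsq n) \o fst) (g := snd)) => //.
  by apply: measurableT_comp => //; exact: measurable_tsq.
pose h (p : n.-tuple Rm * Rm) : \bar R := (expR (- p.2) * \1_D p)%:E.
have mh : measurable_fun setT h.
  apply/measurable_EFinP; apply: measurable_funM; last exact: measurable_indic.
  exact: (measurableT_comp mexp).
have h0 p : (0 <= h p)%E by rewrite lee_fin mulr_ge0 ?expR_ge0.
have := @fubini_tonelli _ _ _ _ R (lam n) leb h mh h0.
(* With u innermost, what remains is e^(-|v|^2), a product of n one-dimensional Gaussians of mass
   sqrt pi each. *)
have -> : (\int[lam n]_v \int[leb]_u h (v, u) = (Num.sqrt pi ^+ n)%:E)%E.
  transitivity (\int[lam n]_v (\prod_(i < n) gauss_fun (tnth v i))%:E)%E; last first.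
    rewrite (integral_prodm_prod leb (g := fun=> gauss_fun)).
    - by rewrite (eq_bigr (fun=> (Num.sqrt pi)%:E)) ?integralT_gauss//
        prodEFin prodr_const card_ord.
    - by move=> _; exact: measurable_gauss_fun.
    - by move=> _; exact: gauss_fun_ge0.
  apply: eq_integral => v _.
  transitivity (\int[leb]_(u in `]tsq v, +oo[) (expR (- u))%:E)%E.
    rewrite [RHS]integral_mkcond; apply: eq_integral => u _.
    rewrite patchE mem_setE in_itv/= andbT /h indicE /=; case: ifPn => tu.
      by rewrite mem_set ?mulr1.
    by rewrite memNset ?mulr0// /D/=; exact/negP.
  rewrite integral_expR_tail /tsq -sumrN expR_sum.
  by congr EFin; apply: eq_bigr => i _; rewrite /gauss_fun.
move=> ->; rewrite -ge0_integralZl//; last 2 first.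
- apply/measurable_funTS/measurable_EFinP/measurable_funM => //.
- by move=> t _; rewrite lee_fin mulr_ge0 ?powR_ge0 ?expR_ge0.
rewrite [RHS]integral_mkcond; apply: eq_integral => u _.
rewrite patchE mem_setE in_itv/= andbT; case: ifPn => u0; last first.
  apply: integral0_eq => v _; rewrite /h indicE memNset ?mulr0// /D/= => vu.
  by move: u0; rewrite (le_lt_trans (tsq_ge0 v) vu).
(* With v innermost, what remains is the volume of the ball of squared radius u, that is u^(n/2)
   times that of the unit ball. *)
transitivity (\int[lam n]_v ((expR (- u))%:E * (\1_(tball n u) v)%:E))%E.
  by apply: eq_integral => v _; rewrite -EFinM /h; congr (_ * _)%:E;
    rewrite !indicE; congr (nat_of_bool _)%:R; apply/idP/idP => /set_mem ?; apply/mem_set.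
rewrite ge0_integralZl//; last first.
  by apply/measurable_EFinP; apply: measurable_indic; exact: measurable_tball.
rewrite integral_indic ?setIT//; last exact: measurable_tball.
rewrite [X in (_ * X)%E = _](_ : _ =
  ((Num.sqrt (u : R) ^+ n)%:E * lam n (tball n 1))%E); last exact: lam_tball.
rewrite muleA -EFinM muleC; congr (_ * _%:E)%E.
by rewrite mulrC; congr (_ * _); rewrite mulrC powRrM powR12_sqrt ?(ltW u0)// powR_mulrn.
Qed.

(** [Gamma] is defined through [fine], so the integral has to be shown finite. The layer-cake
    identity has a finite positive left side, which forces both the volume and the Gamma integral to
    be finite and nonzero. *)
Lemma lam_unit_ball n : (0 < n)%N ->
  lam n (tball n 1) = (Vball R n)%:E /\ 0 < Vball R n.
Proof.
move=> n0; have := gauss_layer_cake n0.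
rewrite /Vball /Gamma; set G := (\int[_]_(_ in _) _)%E; set V := lam n _.
have x0 : 0 < n%:R / 2 :> R by rewrite divr_gt0// ltr0n.
have G0 : (0 <= G)%E.
  by apply: integral_ge0 => t _; rewrite lee_fin mulr_ge0 ?powR_ge0 ?expR_ge0.
have V0 : (0 <= V)%E by exact: measure_ge0.
have P0 : 0 < Num.sqrt (pi : R) ^+ n by rewrite exprn_gt0// sqrtr_gt0 pi_gt0.
have -> : (pi : R) `^ (n%:R / 2) = Num.sqrt pi ^+ n.
  by rewrite mulrC powRrM powR12_sqrt ?pi_ge0// powR_mulrn.
move: G0 V0; case: G => [g| |]//; case: V => [v| |]//; rewrite ?lee_fin.
- move=> g0 v0 /= [E].
  have gn0 : 0 < n%:R / 2 * g.
    rewrite lt_neqAle mulr_ge0 ?(ltW x0)// andbT eq_sym; apply/eqP => g00.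
    by move: P0; rewrite E g00 mulr0 ltxx.
  by rewrite E mulfK ?gt_eqF//; split => //;
    move: P0; rewrite E pmulr_lgt0.
- move=> g0 _; rewrite -EFinM mulyr; case: (sgrP (_ * g)) => [e|e|e].
  + by rewrite mul0e => -[] E; move: P0; rewrite E ltxx.
  + by rewrite mul1e.
  + by move: e; rewrite ltNge mulr_ge0// ltW.
- move=> _ v0; rewrite gt0_muley ?lte_fin// mulry; case: (sgrP v) => [e|e|e].
  + by rewrite mul0e => -[] E; move: P0; rewrite E ltxx.
  + by rewrite mul1e.
  + by move: e; rewrite ltNge v0.
- by move=> _ _; rewrite gt0_muley ?lte_fin// mulyy.
Qed.

End BallVolume.
Arguments tball {R} n rho.

(** * Gaussian bathtub inequality and Voronoi cells *)

Section Bathtub.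
Context {R : realType}.
Local Notation Rm := (measurableTypeR R).
Local Notation leb := (@lebesgue_measure R).
Local Notation lam := (prodm leb).
Variables (n : nat) (sigma : R).
Hypothesis sigma0 : 0 < sigma.
Local Notation nu := (prodm (normal_prob 0 sigma) n).

(** The Gaussian density as a function of the squared norm; since it is radial and decreasing, its
    value at [rho] is the threshold constant of the bathtub inequality. *)
Definition gauss_density (r : R) : R :=
  normal_peak sigma ^+ n * expR (- r / (sigma ^+ 2 *+ 2)).

Lemma gauss_density_ge0 r : 0 <= gauss_density r.
Proof. by rewrite mulr_ge0 ?expR_ge0// exprn_ge0// normal_peak_ge0. Qed.

Lemma gauss_density_le r1 r2 : r1 <= r2 -> gauss_density r2 <= gauss_density r1.
Proof.
move=> r12; rewrite ler_wpM2l ?exprn_ge0 ?normal_peak_ge0// ler_expR.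
by rewrite ler_wpM2r ?lerN2// invr_ge0 mulrn_wge0// sqr_ge0.
Qed.

Lemma gauss_densityE (v : n.-tuple Rm) :
  \prod_(i < n) normal_pdf 0 sigma (tnth v i) = gauss_density (tsq v).
Proof.
under eq_bigr do rewrite normal_pdfE ?gt_eqF// /normal_fun subr0.
rewrite big_split/= prodr_const card_ord -expR_sum; congr (_ * expR _).
by rewrite -mulr_suml sumrN.
Qed.

Lemma measurable_gauss_density_tsq :
  measurable_fun [set: n.-tuple Rm] (fun v => gauss_density (tsq v)).
Proof.
apply: measurable_funM => //; apply: measurableT_comp => //.
apply: measurable_funM => //; apply: measurableT_comp => //.
exact: measurable_tsq.
Qed.

Lemma nuE (A : set (n.-tuple Rm)) : measurable A ->
  nu A = (\int[lam n]_v ((\1_A v)%:E * (gauss_density (tsq v))%:E))%E.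
Proof.
move=> mA; rewrite -[in LHS](setIT A) -integral_indic//.
rewrite (@integral_prodm_density _ _ _ (normal_prob 0 sigma) leb (normal_pdf 0 sigma)).
- by apply: eq_integral => v _; rewrite gauss_densityE.
- exact: measurable_normal_pdf.
- exact: normal_pdf_ge0.
- by move=> f mf f0; exact: integral_normal_prob.
- by apply/measurable_EFinP; exact: measurable_indic.
- by move=> v; rewrite lee_fin.
Qed.

(* [(phi - c) (1_U - 1_B) <= 0] pointwise, as [phi >= c] on [B] and [phi <= c] off [B]. *)
Lemma bathtub (U : set (n.-tuple Rm)) (rho : R) : measurable U ->
  (nu U + (gauss_density rho)%:E * lam n (tball n rho) <=
   nu (tball n rho) + (gauss_density rho)%:E * lam n U)%E.
Proof.
move=> mU; have mB := @measurable_tball _ n rho.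
have mg : measurable_fun [set: n.-tuple Rm] (fun v => (gauss_density (tsq v))%:E).
  by apply/measurable_EFinP; exact: measurable_gauss_density_tsq.
have mI (A : set (n.-tuple Rm)) : measurable A ->
    measurable_fun [set: n.-tuple Rm] (fun v => (\1_A v : R)%:E).
  by move=> mA; apply/measurable_EFinP; exact: measurable_indic.
have g0 r : (0 <= (gauss_density r)%:E)%E by rewrite lee_fin gauss_density_ge0.
have I0 (A : set (n.-tuple Rm)) v : (0 <= (\1_A v : R)%:E)%E by rewrite lee_fin.
have cE (A : set (n.-tuple Rm)) : measurable A ->
    ((gauss_density rho)%:E * lam n A =
    \int[lam n]_v ((gauss_density rho)%:E * (\1_A v)%:E))%E.
  move=> mA; rewrite ge0_integralZl//; last exact: mI.
  by rewrite integral_indic// setIT.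
(* The inequality is kept between sums, not differences, because the volume of [U] may be
   infinite. *)
rewrite !nuE// !cE// -!ge0_integralD//; try by
  [move=> v _; exact: mule_ge0|apply: emeasurable_funM => //; exact: mI
  |apply: measurable_funeM; exact: mI].
apply: ge0_le_integral => //.
- by move=> v _; rewrite adde_ge0// mule_ge0.
- by apply: emeasurable_funD; [apply: emeasurable_funM => //; exact: mI
    |apply: measurable_funeM; exact: mI].
- by apply: emeasurable_funD; [apply: emeasurable_funM => //; exact: mI
    |apply: measurable_funeM; exact: mI].
move=> v _; rewrite -!EFinM -!EFinD lee_fin !indicE.
have [Bv|Bv] := pselect (tball n rho v).
  rewrite (mem_set Bv); have := gauss_density_le (ltW Bv).
  by case: (v \in U); rewrite ?mulr1n ?mulr0n; lra.
rewrite (memNset Bv); move/negP : Bv; rewrite -leNgt => /gauss_density_le.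
by case: (v \in U); rewrite ?mulr1n ?mulr0n; lra.
Qed.

End Bathtub.

(** An injection of [D] into the naturals rewrites the union as a sequence of fibres, each of which
    holds at most one index. *)
Lemma countable_bigcup_measurable d (T : measurableType d) (I : pointedType)
    (D : set I) (F : I -> set T) : countable D ->
  (forall i, D i -> measurable (F i)) -> measurable (\bigcup_(i in D) F i).
Proof.
move=> /countable_injP[f injf] mF.
rewrite (_ : \bigcup_(i in D) F i =
    \bigcup_k \bigcup_(i in D `&` (f @^-1` [set k])) F i); last first.
  apply/seteqP; split => x; first by move=> [i Di Fx]; exists (f i) => //; exists i.
  by move=> [k _ [i [Di _] Fx]]; exists i.
apply: bigcupT_measurable => k.
have [[i Di fi]|no] := pselect (exists2 i, D i & f i = k).
  rewrite (_ : D `&` _ = [set i]) ?bigcup_set1; first exact: mF.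
  apply/seteqP; split => [j [Dj fj]|_ ->]; last by [].
  by apply: injf; rewrite ?inE//; rewrite [LHS]fj fi.
rewrite (_ : D `&` _ = set0) ?bigcup_set0//.
by rewrite -subset0 => j [Dj fj]; apply: no; exists j.
Qed.

Section Cells.
Context {R : realType} (n : nat).
Local Notation Rm := (measurableTypeR R).
Local Notation leb := (@lebesgue_measure R).
Local Notation lam := (prodm leb).

Definition trow (v : n.-tuple Rm) : 'rV[R]_n := \row_i tnth v i.

(** The Voronoi cell recentred at the origin, hence a set of noise vectors: decoding fails exactly
    when the noise leaves it. *)
Definition cell (C : set 'rV[R]_n) (y : 'rV[R]_n) : set (n.-tuple Rm) :=
  [set v | voronoi C y (y + trow v)].

Lemma sqnorm_trow v : sqnorm (trow v) = tsq v.
Proof. by apply: eq_bigr => i _; rewrite mxE. Qed.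

Lemma measurable_sqnorm_trow (z : 'rV[R]_n) :
  measurable_fun [set: n.-tuple Rm] (fun v => sqnorm (z + trow v)).
Proof.
apply: measurable_sum => i; apply: (measurable_funX 2).
rewrite (_ : (fun _ => _) = (fun v : n.-tuple Rm => z 0 i + tnth v i)).
  apply: measurable_funD => //.
  exact: (@measurable_tnth _ Rm n i).
by apply/funext => v; rewrite !mxE.
Qed.

(** A countable intersection of one closed quadratic inequality per competing point, handled through
    complements. *)
Lemma measurable_cell C y : countable C -> measurable (cell C y).
Proof.
move=> cC; have E v z : y + trow v - z = (y - z) + trow v by rewrite addrAC.
rewrite (_ : cell C y = \bigcap_(y' in C)
    [set v | sqnorm ((y - y) + trow v) <= sqnorm ((y - y') + trow v)]); last first.
  apply/seteqP; split => v H y' Cy'; have := H y' Cy'; first by rewrite /= !E.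
  by rewrite /= -!E.
rewrite -[X in measurable X]setCK setC_bigcap; apply: measurableC.
apply: countable_bigcup_measurable => // y' _; apply: measurableC.
rewrite -[X in measurable X]setTI.
by apply: (measurable_fun_ler (f := fun v => sqnorm ((y - y) + trow v))
  (g := fun v => sqnorm ((y - y') + trow v))) => //; exact: measurable_sqnorm_trow.
Qed.

(** The truncation cube for the noise; [b] is its half-side, whereas [cube] takes the full side. *)
Definition cubeK (b : R) : set (n.-tuple Rm) := [set v | forall i, `|tnth v i : R| < b].

Lemma cubeKE b : cubeK b = box (fun=> `](- b), b[%classic).
Proof.
by apply/seteqP; split => v H i; have := H i; rewrite /= in_itv/= ltr_norml.
Qed.

Lemma measurable_cubeK b : measurable (cubeK b).
Proof. by rewrite cubeKE; exact: measurable_box. Qed.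

(* Cells contracted towards their centres are disjoint without any tie-breaking. *)
Lemma contracted_cells_disjoint C y y' (t : R) u u' : 0 < t < 1 -> C y -> C y' ->
  cell C y u -> cell C y' u' -> y + t *: trow u = y' + t *: trow u' -> y = y'.
Proof.
move=> /andP[t0 t1] Cy Cy' /(_ _ Cy') uy /(_ _ Cy) uy' E.
suff w0 : sqnorm (y - y') <= 0.
  apply/rowP => i; apply/eqP; rewrite -subr_eq0 -sqrf_eq0.
  have := w0; rewrite le_eqVlt ltNge sumr_ge0 ?orbF => [|j _]; last exact: sqr_ge0.
  rewrite psumr_eq0 => [/allP /(_ i)|j _]; last exact: sqr_ge0.
  by rewrite mem_index_enum => /(_ isT); rewrite !mxE.
(* Substituting u' = u + (y - y')/t, the two Voronoi inequalities add up to 2 |y - y'|^2 (1 - 1/t)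
   >= 0, whose last factor is negative. *)
have H : 0 <= \sum_(i < n) (2 * (y 0 i - y' 0 i) ^+ 2 * (1 - t^-1)).
  apply: le_trans (_ : 0 <= (sqnorm (y + trow u - y') - sqnorm (y + trow u - y)) +
     (sqnorm (y' + trow u' - y) - sqnorm (y' + trow u' - y'))) _.
    by rewrite addr_ge0// subr_ge0.
  rewrite /sqnorm -!sumrB -big_split/= le_eqVlt; apply/orP; left; apply/eqP.
  apply: eq_bigr => i _; rewrite !mxE.
  have : tnth u' i = tnth u i + (y 0 i - y' 0 i) / t :> R.
    move/rowP : E => /(_ i); rewrite !mxE => E.
    apply: (mulfI (lt0r_neq0 t0)); rewrite mulrDr mulrCA divff ?gt_eqF// mulr1.
    by move: E; lra.
  by move=> ->; field; exact: lt0r_neq0.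
move: H; rewrite -mulr_suml -mulr_sumr.
have t1' : 1 - t^-1 < 0 by rewrite subr_lt0 invf_gt1.
rewrite nmulr_lge0// pmulr_rle0// => H.
by apply: le_trans H; rewrite le_eqVlt; apply/orP; left; apply/eqP;
  apply: eq_bigr => i _; rewrite !mxE.
Qed.

End Cells.

(** * Bernoulli-type inequalities for limits of small parameters *)

Lemma onem_exprn_ge (R : realDomainType) (e : R) n : 0 <= e <= 1 ->
  1 - n%:R * e <= (1 - e) ^+ n.
Proof.
move=> /andP[e0 e1]; elim: n => [|n IH]; first by rewrite mul0r subr0 expr0.
rewrite exprSr (le_trans _ (ler_wpM2r _ IH)) ?subr_ge0//.
rewrite -natr1; have : 0 <= n%:R * e * e by rewrite !mulr_ge0.
lra.
Qed.

(** The limit t -> 1, made explicit by taking t = 1 - d and applying Bernoulli's inequality. *)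
Lemma le_contracted (R : realType) (x y : R) n : 0 <= x ->
  (forall t, 0 < t < 1 -> t ^+ n * x <= y) -> x <= y.
Proof.
move=> x0 H; apply/ler_addgt0Pr => e e0.
(* The bound 1/2 keeps t positive, the other one makes n x d at most e; the added 1 keeps the
   denominator positive. *)
pose d := Num.min 2^-1 (e / (n%:R * x + 1)).
have D0 : 0 < n%:R * x + 1 by rewrite ltr_wpDl// mulr_ge0.
have d0 : 0 < d by rewrite lt_min invr_gt0 ltr0n/= divr_gt0.
have d1 : d <= 2^-1 by rewrite ge_min lexx.
have de : d * (n%:R * x + 1) <= e by rewrite -ler_pdivlMr// ge_min lexx orbT.
have t01 : 0 < 1 - d < 1 by apply/andP; split; lra.
have := H _ t01; have := @onem_exprn_ge R d n.
have -> : 0 <= d <= 1 by apply/andP; split; lra.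
move=> /(_ isT) /(ler_wpM2r x0) le1 le2.
rewrite -lerBlDr; apply: le_trans (le_trans le1 le2).
have -> : (1 - n%:R * d) * x = x - d * (n%:R * x) by ring.
rewrite lerB// (le_trans _ de)// ler_pM2l//; lra.
Qed.

(** The crude constant 3^n closes the induction: in (1 + 3^n e)(1 + e), the terms e and 3^n e^2 are
    each at most 3^n e. *)
Lemma exprn_onep_le (R : realDomainType) (e : R) n : 0 <= e <= 1 ->
  (1 + e) ^+ n <= 1 + 3 ^+ n * e.
Proof.
move=> /andP[e0 e1]; elim: n => [|n IH]; first by rewrite !expr0; lra.
rewrite exprSr (le_trans (ler_wpM2r _ IH)) ?addr_ge0//.
have : 1 <= 3 ^+ n :> R by rewrite exprn_ege1// ler1n.
rewrite [3 ^+ n.+1]exprSr; set k := 3 ^+ n => k1.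
have : k * e * e <= k * e by rewrite ler_piMr// mulr_ge0// (le_trans _ k1).
have : 1 * e <= k * e by rewrite ler_wpM2r.
lra.
Qed.

Lemma exists_small_onep (R : realType) (K e : R) n : 0 <= K -> 0 < e ->
  exists2 eta, 0 < eta & K * (1 + eta) ^+ n <= K + e.
Proof.
move=> K0 e0; have D0 : 0 < K * 3 ^+ n + 1 by rewrite ltr_wpDl// mulr_ge0// exprn_ge0.
exists (Num.min 1 (e / (K * 3 ^+ n + 1))); first by rewrite lt_min ltr01/= divr_gt0.
set d := Num.min _ _.
have d0 : 0 < d by rewrite lt_min ltr01/= divr_gt0.
have d1 : d <= 1 by rewrite ge_min lexx.
have de : d * (K * 3 ^+ n + 1) <= e by rewrite -ler_pdivlMr// ge_min lexx orbT.
rewrite (le_trans (ler_wpM2l K0 (@exprn_onep_le R d n _))) ?(ltW d0)//.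
have -> : K * (1 + 3 ^+ n * d) = K + d * (K * 3 ^+ n) by ring.
rewrite lerD2l (le_trans _ de)// ler_pM2l//; lra.
Qed.

(** * Total volume of the truncated cells *)

Section Packing.
Context {R : realType} (n : nat).
Local Notation Rm := (measurableTypeR R).
Local Notation leb := (@lebesgue_measure R).
Local Notation lam := (prodm leb).

Lemma lam_box_sym (r : 'I_n -> R) : (forall i, 0 <= r i) ->
  lam n (box (fun i => `](- r i), r i[%classic)) = (\prod_i (2 * r i))%:E.
Proof.
move=> r0; rewrite prodm_box//.
rewrite -prodEFin; apply: eq_bigr => i _.
etransitivity; first exact: lebesgue_measure_itv.
rewrite /= lte_fin; case: ifPn => ri.
  by rewrite -EFinB; congr EFin; ring.
suff -> : r i = 0 by rewrite mulr0.
by apply/eqP; rewrite eq_le r0 andbT; move: ri; rewrite -leNgt; lra.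
Qed.

Lemma cells_packing (C A : set 'rV[R]_n) (l : 'I_n -> R) (b : R) :
  countable C -> finite_set A -> A `<=` C -> 0 < b -> (forall i, 0 <= l i) ->
  (forall y i, A y -> `|y 0 i| < l i) ->
  (\sum_(y \in A) lam n (cell C y `&` cubeK b) <=
   (\prod_i (2 * (l i + b)))%:E)%E.
Proof.
move=> cC fA AC b0 l0 Al.
have mU y : measurable (cell C y `&` cubeK b).
  by apply: measurableI; [exact: measurable_cell|exact: measurable_cubeK].
have mul t : 0 < t < 1 -> ((t ^+ n)%:E *
    \sum_(y \in A) lam n (cell C y `&` cubeK b) <= (\prod_i (2 * (l i + b)))%:E)%E.
  move=> t01; have /andP[t0 t1] := t01.
  (* The contracted copy y + t U of the truncated cell U, written as the preimage of U under x -> (x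
     - y)/t. *)
  pose E (y : 'rV[R]_n) := taff t^-1 (fun i => - (y 0 i / t)) @^-1` (cell C y `&` cubeK b).
  have mE y : measurable (E y).
    by rewrite -[X in measurable X]setTI; exact: measurable_taff.
  have lamE y : lam n (E y) = ((t ^+ n)%:E * lam n (cell C y `&` cubeK b))%E.
    by rewrite prodm_taff ?invr_gt0// exprVn invrK.
  have trowE (y : 'rV[R]_n) x : y + t *: trow (taff t^-1 (fun i => - (y 0 i / t)) x) = trow x.
    apply/rowP => i; rewrite !mxE tnth_mktuple; field; exact: lt0r_neq0.
  rewrite ge0_mule_fsumr//; under eq_fsbigr do rewrite -lamE.
  rewrite -measure_fin_bigcup//; last first.
    move=> y y' Ay Ay' [x [[xy _] [xy' _]]].
    apply: (contracted_cells_disjoint t01 (AC _ Ay) (AC _ Ay') xy xy').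
    by rewrite !trowE.
  rewrite -lam_box_sym => [|i]; last by rewrite addr_ge0// ltW.
  apply: le_measure; rewrite ?inE.
  - exact: fin_bigcup_measurable.
  - by apply: measurable_box => i.
  move=> x [y Ay [_ xK]] i; rewrite /= in_itv/= -ltr_norml.
  have /rowP/(_ i) := trowE y x; rewrite !mxE => <-.
  rewrite (le_lt_trans (ler_normD _ _))// ltr_leD//; first exact: Al.
  rewrite normrM (gtr0_norm t0) -[leRHS]mul1r ler_pM// ?ltW//; exact: xK.
have S0 : (0 <= \sum_(y \in A) lam n (cell C y `&` cubeK b))%E.
  by apply: fsume_ge0.
(* The limit argument needs a finite sum; the single value t = 1/2 already excludes an infinite
   one. *)
move: S0 mul; case: (\sum_(y \in A) _)%E => [s| |]// s0 mul.
- rewrite lee_fin; apply: (@le_contracted _ _ _ n) => // t /mul.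
- have h0 : (0 < 2^-1 :> R)%R by rewrite invr_gt0.
  have h1 : (2^-1 < 1 :> R)%R by rewrite invf_lt1// ltr1n.
  have := mul 2^-1; rewrite h0 h1 => /(_ isT).
  by rewrite gt0_muley// lte_fin exprn_gt0.
Qed.

End Packing.

(** * The average error probability for a fixed fading vector *)

Section AverageError.
Context {R : realType} (d : measure_display) (T : measurableType d).
Variables (P : probability T R) (n : nat) (sigma : R).
Variables (Zs : 'I_n -> T -> R) (S : set 'rV[R]_n).
Local Notation Rm := (measurableTypeR R).
Local Notation leb := (@lebesgue_measure R).
Local Notation lam := (prodm leb n).
Local Notation nu := (prodm (normal_prob 0 sigma) n).

Definition tuple_of_rvs (X : 'I_n -> T -> R) (t : T) : n.-tuple Rm :=
  [tuple X i t | i < n].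

Lemma measurable_tuple_of_rvs X : (forall i, measurable_fun setT (X i)) ->
  measurable_fun setT (tuple_of_rvs X).
Proof.
move=> mX; apply/measurable_fun_tnthP => i.
by apply: (eq_measurable_fun (X i)) => // t _; rewrite /= tnth_mktuple.
Qed.

Lemma trow_tuple_of_rvs X t : trow (tuple_of_rvs X t) = rvec X t.
Proof. by apply/rowP => i; rewrite !mxE tnth_mktuple. Qed.

Hypotheses (n0 : (0 < n)%N) (sigma0 : 0 < sigma).
Hypothesis cS : countable S.
Hypothesis law_Z : forall A, measurable A -> P (tuple_of_rvs Zs @^-1` A) = nu A.

Lemma nuT : nu setT = 1%E.
Proof. by rewrite -law_Z// preimage_setT probability_setT. Qed.

Lemma nu_fin A : measurable A -> nu A = (fine (nu A))%:E.
Proof.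
move=> mA; rewrite fineK// ge0_fin_numE//; apply: le_lt_trans (ltry 1).
by rewrite -nuT; apply: le_measure; rewrite ?inE.
Qed.

Lemma nuC A : measurable A -> fine (nu (~` A)) = 1 - fine (nu A).
Proof.
move=> mA; have : (nu A + nu (~` A) = 1)%E.
  rewrite -measureU//; [by rewrite setUv; exact: nuT|exact: measurableC|exact: setICr].
by rewrite (nu_fin mA) (nu_fin (measurableC mA)) => -[]; lra.
Qed.

Lemma chanE (h x : 'rV[R]_n) i : (chan h x) 0 i = x 0 i * h 0 i.
Proof. by rewrite /chan mul_mx_diag mxE. Qed.

Lemma chan_inj (h : 'rV[R]_n) : (forall i, 0 < h 0 i) -> injective (chan h).
Proof.
move=> h0 x y /rowP E; apply/rowP => i; have := E i.
by rewrite !chanE => /(mulIf (lt0r_neq0 (h0 i))).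
Qed.

Lemma error_probE C y : countable C ->
  fine (P [set t | ~ voronoi C y (y + rvec Zs t)]) = 1 - fine (nu (cell C y)).
Proof.
move=> cC; rewrite -nuC; last exact: measurable_cell.
congr fine; etransitivity; last first.
  by apply: law_Z; apply: measurableC; exact: measurable_cell.
congr (P _); apply/seteqP; split => t;
  by rewrite /cell /= trow_tuple_of_rvs.
Qed.

Local Notation gd := (gauss_density n sigma).

(** The bathtub inequality for the truncated cell, read on complements. The part of the cell that is
    cut off has probability at most that of the complement of the cube. *)
Lemma cell_error_ge C y b rho : countable C -> 0 < b -> 0 < rho ->
  fine (nu (~` tball n rho)) - fine (nu (~` cubeK b)) +
    gd rho * fine (lam (tball n rho)) - gd rho * fine (lam (cell C y `&` cubeK b))
  <= 1 - fine (nu (cell C y)).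
Proof.
move=> cC b0 rho0.
have mK : measurable (@cubeK R n b) by exact: measurable_cubeK.
have mc : measurable (cell C y) by exact: measurable_cell.
have mcK := measurableI _ _ mc mK.
have mB := @measurable_tball R n rho.
have le1 : fine (nu (cell C y)) <=
    fine (nu (cell C y `&` cubeK b)) + fine (nu (~` cubeK b)).
  rewrite -lee_fin EFinD -!nu_fin//; last exact: measurableC.
  apply: (@le_trans _ _ (nu ((cell C y `&` cubeK b) `|` ~` cubeK b))).
    apply: le_measure; rewrite ?inE//; first by apply: measurableU => //; exact: measurableC.
    by move=> v cv; have [vK|vK] := pselect (cubeK b v); [left|right].
  by apply: measureU2 => //; exact: measurableC.
have lB : lam (tball n rho) = (fine (lam (tball n rho)))%:E.
  by rewrite fineK// lam_tball// (lam_unit_ball n0).1.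
have lcK : lam (cell C y `&` cubeK b) = (fine (lam (cell C y `&` cubeK b)))%:E.
  rewrite fineK// ge0_fin_numE//.
  apply: (@le_lt_trans _ _ (lam (cubeK b))); first by apply: le_measure; rewrite ?inE.
  by rewrite cubeKE (lam_box_sym (r := fun=> b)) ?ltry// => _; exact: ltW.
have := @bathtub R n sigma sigma0 (cell C y `&` cubeK b) rho mcK.
rewrite lB lcK (nu_fin mcK) (nu_fin mB) -!EFinM -!EFinD lee_fin nuC//.
move: le1; lra.
Qed.

(** Averages [cell_error_ge] over the received points; only the sum of the truncated volumes depends
    on the geometry, and [cells_packing] bounds it. *)
Lemma avg_err_ge (h : 'rV[R]_n) (a b rho : R) : (forall i, 0 < h 0 i) ->
  0 < a -> 0 < b -> 0 < rho -> finite_set (S `&` cube a) ->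
  (0 < #|` fset_set (S `&` cube a)|%fset)%N ->
  fine (nu (~` tball n rho)) - fine (nu (~` cubeK b)) +
    gd rho * fine (lam (tball n rho)) -
    gd rho * (\prod_i (h 0 i * a + 2 * b)) / (#|` fset_set (S `&` cube a)|%fset)%:R
  <= avg_err P Zs S h a.
Proof.
move=> h0 a0 b0 rho0 fin N0; rewrite /avg_err.
set A := [set chan h x | x in S] `&` _; pose C := chan h @` S.
have cC : countable C by apply: sub_countable cS; exact: card_image_le.
(* Positive fading makes the channel injective, so the received points are counted by the
   transmitted ones. *)
have AE : A = chan h @` (S `&` cube a).
  apply/seteqP; split => x; last by move=> [s [Ss ca] <-]; split; exists s.
  by move=> [[s Ss <-] [s' cs' /(chan_inj h0) E]]; exists s => //; split => //; rewrite -E.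
have fA : finite_set A by rewrite AE; exact: finite_image.
have NA : #|` fset_set A| = #|` fset_set (S `&` cube a)|.
  rewrite AE fset_set_image// card_imfset//=; exact: chan_inj.
rewrite NA; set N := #|` _| in N0 *.
have N0' : 0 < N%:R :> R by rewrite ltr0n.
set q := fine (nu _) - _ + _.
rewrite ler_pdivlMr// mulrBl divfK ?gt_eqF//.
have pack : (\sum_(y \in A) lam (cell C y `&` cubeK b) <=
    (\prod_i (h 0 i * a + 2 * b))%:E)%E.
  apply: le_trans (_ : _ <= (\prod_i (2 * (h 0 i * (a / 2) + b)))%:E)%E _.
    apply: cells_packing => //.
    - by move=> y; rewrite AE => -[s [Ss _] <-]; exists s.
    - by move=> i; rewrite mulr_ge0 ?ltW// divr_gt0.
    - move=> y i; rewrite AE => -[s [_ cs] <-]; rewrite chanE normrM mulrC.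
      by rewrite (gtr0_norm (h0 i)) ltr_pM2l//; exact: cs.
  rewrite lee_fin le_eqVlt; apply/orP; left; apply/eqP; apply: eq_bigr => i _; by field.
have lcK y : lam (cell C y `&` cubeK b) = (fine (lam (cell C y `&` cubeK b)))%:E.
  rewrite fineK// ge0_fin_numE//.
  apply: (@le_lt_trans _ _ (lam (cubeK b))).
    apply: le_measure; rewrite ?inE//; last exact: measurable_cubeK.
    by apply: measurableI; [exact: measurable_cell|exact: measurable_cubeK].
  by rewrite cubeKE (lam_box_sym (r := fun=> b)) ?ltry// => _; exact: ltW.
move: pack; under eq_fsbigr do rewrite lcK.
rewrite fsumEFin// lee_fin => pack.
rewrite (fsbig_finite _ _ fA) /= in pack; rewrite (fsbig_finite _ _ fA) /=.
have -> : q * N%:R = \sum_(y <- fset_set A) q.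
  by rewrite big_const_seq count_predT iter_addr_0 mulr_natr /N -NA.
apply: le_trans (_ : \sum_(y <- fset_set A)
    (q - gd rho * fine (lam (cell C y `&` cubeK b))) <= _).
  rewrite sumrB -mulr_sumr lerB// ler_wpM2l// gauss_density_ge0//.
rewrite ler_sum// => y _; rewrite error_probE//; exact: cell_error_ge.
Qed.

End AverageError.

(** * From a finite cube to the limsup *)

Section Limsup.
Context {R : realType} (d : measure_display) (T : measurableType d).
Variables (P : probability T R) (n : nat) (sigma : R).
Variables (Zs : 'I_n -> T -> R) (S : set 'rV[R]_n).
Local Notation Rm := (measurableTypeR R).
Local Notation leb := (@lebesgue_measure R).
Local Notation lam := (prodm leb n).
Local Notation nu := (prodm (normal_prob 0 sigma) n).
Hypotheses (n0 : (0 < n)%N) (sigma0 : 0 < sigma).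
Hypothesis cS : countable S.
Hypothesis law_Z : forall A, measurable A -> P (tuple_of_rvs Zs @^-1` A) = nu A.

(** Cubes of integer half-side exhaust the space, and [nu] is continuous from below with total mass
    1. *)
Lemma nu_cubeK_small (e : R) : 0 < e ->
  exists2 b, 0 < b & fine (nu (~` cubeK b)) <= e.
Proof.
move=> e0; pose F k := @cubeK R n k.+1%:R.
have mF k : measurable (F k) by exact: measurable_cubeK.
have FT : \bigcup_k F k = setT.
  apply/seteqP; split => // v _.
  exists (Num.truncn (\sum_(i < n) `|tnth v i : R|)) => //= i.
  apply: (@le_lt_trans _ _ (\sum_(i < n) `|tnth v i : R|)).
    by rewrite (bigD1 i)//= lerDl sumr_ge0.
  by rewrite truncnS_gt.
have : nu \o F @ \oo --> nu (\bigcup_k F k).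
  apply: nondecreasing_cvg_mu => //; first by rewrite FT.
  apply/nondecreasing_seqP => k; apply/subsetPset => v H i.
  by apply: lt_le_trans (H i) _; rewrite ler_nat.
have nuT1 : nu (\bigcup_k F k) = 1%E by rewrite FT; exact: nuT law_Z.
rewrite nuT1 => /fine_cvgP[_] /cvgrPdist_lt /(_ e e0)[k _ /(_ k (leqnn k))] /= H.
exists k.+1%:R => //; rewrite (nuC law_Z); last exact: measurable_cubeK.
by move: H; rewrite distrC ltr_norml => /andP[]; rewrite -/(F k); lra.
Qed.

(** Infinitely many points in one cube would give an infinite count in every larger cube, hence
    infinite density. *)
Lemma finite_cube g a : ic_density S = g%:E -> finite_set (S `&` cube a).
Proof.
move=> dS; apply: contrapT => infa.
suff : ic_density S = +oo%E by rewrite dS.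
apply/eqP; rewrite -leye_eq; apply: le_ereal_inf_tmp => _ [M _ <-].
apply: ereal_sup_ubound; exists (Num.max (Num.max M a) 0 + 1) => /=.
  by rewrite ltr_pwDr// !le_max lexx.
set a' := _ + 1; have aa' : a <= a' by rewrite ler_wpDr// !le_max lexx orbT.
have a'0 : 0 < a' by rewrite ltr_pwDr// le_max lexx orbT.
rewrite /ecard; case: pselect => [fin|?].
  exfalso; apply: infa; apply: sub_finite_set fin => x [Sx cx]; split => // i.
  by apply: lt_le_trans (cx i) _; rewrite ler_pM2r// invr_gt0.
by rewrite gt0_mulye// lte_fin invr_gt0 exprn_gt0.
Qed.

(** A limsup provides nearly full cubes only at some arbitrarily large sides; this suffices because
    the error probability is also a limsup. *)
Lemma dense_cube (g M eta : R) : ic_density S = g%:E -> 0 < g -> 0 < eta ->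
  exists2 a, M < a & 0 < a ->
    g * a ^+ n < (#|` fset_set (S `&` cube a)|%fset)%:R * (1 + eta).
Proof.
move=> dS g0 eta0.
have eta1 : 0 < 1 + eta by rewrite addr_gt0.
pose G (a : R) := (ecard (S `&` cube a) * ((a ^+ n)^-1)%:E)%E.
have : ((g / (1 + eta))%:E < ereal_sup [set G a | a in [set a | M < a]%R])%E.
  apply: (@lt_le_trans _ _ (ic_density S)).
    by rewrite dS lte_fin ltr_pdivrMr// ltr_pMr// ltrDl.
  by apply: ereal_inf_lbound; exists M.
move=> /ereal_sup_gt[_ [a Ma <-]].
rewrite /G /ecard; case: pselect => [?|infin]; last by case: (infin (finite_cube a dS)).
rewrite -EFinM lte_fin => H; exists a => // a0.
by move: H; rewrite ltr_pdivrMr// mulrAC ltr_pdivlMr// exprn_gt0.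
Qed.

(** The ball is given the volume det h / g available per received point, so at the sides found by
    [dense_cube] the two volume terms of [avg_err_ge] cancel up to an arbitrarily small error. *)
Lemma limsup_avg_err_ge (h : 'rV[R]_n) (g rho : R) : (forall i, 0 < h 0 i) ->
  0 < g -> ic_density S = g%:E -> 0 < rho ->
  fine (lam (tball n rho)) = (\prod_i h 0 i) / g ->
  ((fine (nu (~` tball n rho)))%:E <=
    limsup_pinfty (fun a => (avg_err P Zs S h a)%:E))%E.
Proof.
move=> h0 g0 dS rho0 volB; apply: le_ereal_inf_tmp => _ [M _ <-].
apply/lee_addgt0Pr => e e0.
(* Half of [e] pays for the truncation of the noise, the other half for the factor (1 +
   eta)^(n+1). *)
have e20 : 0 < e / 2 by rewrite divr_gt0.
have [b b0 bK] := nu_cubeK_small e20.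
set c := gauss_density n sigma rho.
have c0 : 0 <= c by exact: gauss_density_ge0.
set D := \prod_i h 0 i in volB.
have D0 : 0 < D by apply: prodr_gt0 => i _; exact: h0.
have K0 : 0 <= c * (D / g) by rewrite mulr_ge0// divr_ge0// ltW.
(* The exponent n + 1 collects n factors from the enlarged sides of the box and one from the deficit
   in the point count. *)
have [eta eta0 etaP] := exists_small_onep n.+1 K0 e20.
(* Beyond [B] the enlargement 2b is below eta h_i a for every i, since the sum dominates each of its
   nonnegative terms. *)
pose B := \sum_i (2 * b / (eta * h 0 i)).
have [a Ma aP] := dense_cube (Num.max (Num.max M B) 0) dS g0 eta0.
have a0 : 0 < a by apply: le_lt_trans Ma; rewrite le_max lexx orbT.
have MA : M < a by apply: le_lt_trans Ma; rewrite !le_max lexx.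
have BA : B < a by apply: le_lt_trans Ma; rewrite !le_max lexx orbT.
have {}aP := aP a0.
have eta1 : 0 < 1 + eta by rewrite addr_gt0.
have N0 : (0 < #|` fset_set (S `&` cube a)|%fset)%N.
  rewrite lt0n; apply/eqP => N0; move: aP; rewrite N0 mul0r ltNge.
  by rewrite mulr_ge0 ?exprn_ge0// ltW.
apply: (@le_trans _ _ ((avg_err P Zs S h a)%:E + e%:E)%E); last first.
  by rewrite leeD2r//; apply: ereal_sup_ubound; exists a.
rewrite -EFinD lee_fin -lerBlDr.
apply: le_trans (avg_err_ge n0 sigma0 cS law_Z h0 a0 b0 rho0 (finite_cube a dS) N0).
move: aP N0; set N := #|` _| => aP N0.
have N0' : 0 < N%:R :> R by rewrite ltr0n.
rewrite -/c volB.
suff : c * (\prod_i (h 0 i * a + 2 * b)) / N%:R <= c * (D / g) * (1 + eta) ^+ n.+1.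
  by move: bK etaP; lra.
have prodle : \prod_i (h 0 i * a + 2 * b) <= D * a ^+ n * (1 + eta) ^+ n.
  have -> : D * a ^+ n * (1 + eta) ^+ n = \prod_i (h 0 i * (a * (1 + eta))).
    by rewrite -mulrA -exprMn big_split/= prodr_const card_ord.
  apply: ler_prod => i _; rewrite addr_ge0 ?mulr_ge0 ?(ltW (h0 i)) ?(ltW a0) ?(ltW b0)//=.
  have : 2 * b / (eta * h 0 i) < a.
    apply: le_lt_trans BA; rewrite /B (bigD1 i)//= lerDl sumr_ge0// => j _.
    by rewrite divr_ge0 ?mulr_ge0 ?ltW.
  rewrite ltr_pdivrMr ?mulr_gt0//; lra.
rewrite ler_pdivrMr//; apply: le_trans (ler_wpM2l c0 prodle) _.
have -> : c * (D / g) * (1 + eta) ^+ n.+1 * N%:R =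
    c * (D / g * (1 + eta) ^+ n * (N%:R * (1 + eta))) by rewrite exprS; ring.
rewrite ler_wpM2l//.
have -> : D * a ^+ n * (1 + eta) ^+ n = D / g * (1 + eta) ^+ n * (g * a ^+ n).
  by field; exact: lt0r_neq0.
by rewrite ler_wpM2l ?ltW// mulr_gt0 ?divr_gt0 ?exprn_gt0.
Qed.

End Limsup.

(** * Independence and integration over the fading *)

(* Unlike [ge0_le_integral], applicable to the integrand of [Pe], a limsup over a real parameter whose measurability is unclear. *)
Lemma ge0_le_integralT d (T : measurableType d) (R : realType)
    (mu : {measure set T -> \bar R}) (f g : T -> \bar R) :
  (forall x, 0 <= f x)%E -> (forall x, f x <= g x)%E ->
  (\int[mu]_x f x <= \int[mu]_x g x)%E.
Proof.
move=> f0 fg; rewrite !ge0_integralTE//; last first.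
  by move=> x; exact: le_trans (f0 x) (fg x).
apply: ge_ereal_sup => _ [h hf <-]; apply: ereal_sup_ubound; exists h => // x.
exact: le_trans (hf x) (fg x).
Qed.

Section Independence.
Context {R : realType} (d : measure_display) (T : measurableType d).
Variables (P : probability T R) (n : nat) (Hs Zs : 'I_n -> T -> R).
Local Notation Rm := (measurableTypeR R).
Hypothesis mH : forall i, measurable_fun [set: T] (Hs i).
Hypothesis mZ : forall i, measurable_fun [set: T] (Zs i).
Hypothesis HZ : mutually_independent P (HZfamily Hs Zs).

Let HT := tuple_of_rvs Hs.
Let ZT := tuple_of_rvs Zs.
Let mHT : measurable_fun setT HT := measurable_tuple_of_rvs mH.
Let mZT : measurable_fun setT ZT := measurable_tuple_of_rvs mZ.

Let Pfin A : measurable A -> P A = (fine (P A))%:E.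
Proof. by move=> mA; rewrite fineK// fin_num_measure. Qed.

Let mpre (X : T -> n.-tuple Rm) U : measurable_fun setT X -> measurable U ->
  measurable (X @^-1` U).
Proof. by move=> mX mU; rewrite -[X in measurable X]setTI; exact: mX. Qed.

Lemma joint_box (A B : 'I_n -> set Rm) : (forall i, measurable (A i)) ->
  (forall i, measurable (B i)) ->
  P (HT @^-1` box A `&` ZT @^-1` box B) =
  ((\prod_i fine (P (Hs i @^-1` A i))) * \prod_i fine (P (Zs i @^-1` B i)))%:E.
Proof.
move=> mA mB.
have mAB := measurableI _ _ (mpre mHT (measurable_box mA)) (mpre mZT (measurable_box mB)).
rewrite Pfin//; congr EFin.
pose C (k : 'I_n + 'I_n) : set R := match k with inl i => A i | inr i => B i end.
have mC k : measurable (C k) by case: k.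
have := HZ mC; rewrite big_sumType/= => <-.
congr (fine (P _)); apply/seteqP; split => t.
  move=> [HA ZB] [i|i] _ /=; [have := HA i|have := ZB i];
  by rewrite /= tnth_mktuple.
by move=> H; split=> i; [have := H (inl i) I|have := H (inr i) I];
  rewrite /= tnth_mktuple.
Qed.

Lemma law_box_H (A : 'I_n -> set Rm) : (forall i, measurable (A i)) ->
  P (HT @^-1` box A) = (\prod_i fine (P (Hs i @^-1` A i)))%:E.
Proof.
move=> mA; have := @joint_box A (fun=> setT) mA (fun=> measurableT).
rewrite (_ : ZT @^-1` _ = setT) ?setIT => [->|]; last by apply/seteqP; split.
congr EFin; rewrite [X in _ * X]big1 ?mulr1// => i _.
by rewrite preimage_setT probability_setT.
Qed.

Lemma law_box_Z (B : 'I_n -> set Rm) : (forall i, measurable (B i)) ->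
  P (ZT @^-1` box B) = (\prod_i fine (P (Zs i @^-1` B i)))%:E.
Proof.
move=> mB; have := @joint_box (fun=> setT) B (fun=> measurableT) mB.
rewrite (_ : HT @^-1` _ = setT) ?setTI => [->|]; last by apply/seteqP; split.
congr EFin; rewrite [X in X * _]big1 ?mul1r// => i _.
by rewrite preimage_setT probability_setT.
Qed.

(** First of two extensions beyond boxes: with the fading event fixed as a box, both sides are
    finite measures in the noise event that agree on boxes. [independent_tuples] then frees the
    fading event in the same way. *)
Let indep_boxl (A : 'I_n -> set Rm) V : (forall i, measurable (A i)) -> measurable V ->
  P (ZT @^-1` V `&` HT @^-1` box A) = (P (HT @^-1` box A) * P (ZT @^-1` V))%E.
Proof.
move=> mA mV; have mX := mpre mHT (measurable_box mA).
pose k := NngNum (fine_ge0 (measure_ge0 P (HT @^-1` box A))).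
have -> : P (HT @^-1` box A) = (k%:num)%:E by rewrite Pfin.
apply: (tuple_measure_unique (m1 := pushm (mrestr P mX) mZT)
  (m2 := mscale k (pushm P mZT))) => //.
- move=> B mB; rewrite /= /mscale /pushm /pushforward /mrestr /=.
  by rewrite setIC joint_box// law_box_H// law_box_Z.
- rewrite /= /pushm /pushforward /mrestr preimage_setT setTI.
  by rewrite Pfin// ltry.
Qed.

Lemma independent_tuples U V : measurable U -> measurable V ->
  P (HT @^-1` U `&` ZT @^-1` V) = (P (HT @^-1` U) * P (ZT @^-1` V))%E.
Proof.
move=> mU mV; have mY := mpre mZT mV.
pose k := NngNum (fine_ge0 (measure_ge0 P (ZT @^-1` V))).
rewrite muleC; have -> : P (ZT @^-1` V) = (k%:num)%:E by rewrite Pfin.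
apply: (tuple_measure_unique (m1 := pushm (mrestr P mY) mHT)
  (m2 := mscale k (pushm P mHT))) => //.
- move=> A mA; rewrite /= /mscale /pushm /pushforward /mrestr /=.
  rewrite setIC indep_boxl// muleC; congr (_ * _)%E.
  by rewrite Pfin.
- rewrite /= /pushm /pushforward /mrestr preimage_setT setTI.
  by rewrite Pfin// ltry.
Qed.

Definition law_tuple (X : 'I_n -> T -> R) (mX : forall i, measurable_fun setT (X i)) :=
  pushm P (measurable_tuple_of_rvs mX).

HB.instance Definition _ X mX := Measure.on (@law_tuple X mX).

Let law_tuple_fin X mX : fin_num_fun (@law_tuple X mX).
Proof. by move=> A mA; apply: fin_num_measure; exact: mpre (measurable_tuple_of_rvs mX) mA. Qed.

HB.instance Definition _ X mX :=
  Measure_isFinite.Build _ _ _ (@law_tuple X mX) (law_tuple_fin mX).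

(** Independence makes the joint law a product measure, so its value is the integral of the noise
    probabilities of the sections: conditioning on the fading. *)
Lemma joint_law (nu : {sigma_finite_measure set (n.-tuple Rm) -> \bar R})
    (X : set (n.-tuple Rm * n.-tuple Rm)) :
  (forall A, measurable A -> P (ZT @^-1` A) = nu A) -> measurable X ->
  P [set t | X (HT t, ZT t)] = (\int[P]_t nu (xsection X (HT t)))%E.
Proof.
move=> nuE mX.
have mHZT : measurable_fun setT (fun t => (HT t, ZT t)) by exact: measurable_fun_pair.
have := @product_measure_unique _ _ _ _ R (law_tuple mH) nu (pushm P mHZT).
move=> /(_ _ _ mX) /= <-.
- rewrite /product_measure1 /law_tuple ge0_integral_pushm//.
  exact: measurable_fun_xsection.
- by move=> A B mA mB; rewrite -nuE// -independent_tuples.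
Qed.

End Independence.

Lemma law_Z_normal (R : realType) (d : measure_display) (T : measurableType d)
  (P : probability T R) (n : nat) (sigma : R) (Hs Zs : 'I_n -> T -> R) :
  (forall i, measurable_fun [set: T] (Zs i)) ->
  (forall i (B : set R), measurable B -> P (Zs i @^-1` B) = normal_prob 0 sigma B) ->
  mutually_independent P (HZfamily Hs Zs) ->
  (forall i, measurable_fun [set: T] (Hs i)) ->
  forall A, measurable A ->
    P (tuple_of_rvs Zs @^-1` A) = prodm (normal_prob 0 sigma) n A.
Proof.
move=> mZ lawZ HZ mH A mA.
apply: (tuple_measure_unique (m1 := pushm P (measurable_tuple_of_rvs mZ))
  (m2 := prodm (normal_prob 0 sigma) n)) => //.
- move=> B mB; rewrite /= /pushm /pushforward (law_box_Z mH mZ HZ)//.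
  rewrite prodm_box// -prodEFin; apply: eq_bigr => i _.
  rewrite fineK; first exact (lawZ i (B i) (mB i)).
  apply: fin_num_measure; rewrite -[X in measurable X]setTI.
  have mBi : measurable (B i : set R) := mB i.
  exact: mZ.
- by rewrite /= /pushm /pushforward preimage_setT probability_setT ltry.
Qed.

Lemma avg_err_ge0 (R : realType) (d : measure_display) (T : measurableType d)
  (P : probability T R) (n : nat) (Zs : 'I_n -> T -> R) S h a :
  0 <= avg_err P Zs S h a.
Proof.
rewrite /avg_err divr_ge0// fsumr_ge0// => y _; exact: fine_ge0.
Qed.

Lemma limsup_pinfty_ge0 (R : realType) (g : R -> R) : (forall a, 0 <= g a) ->
  (0 <= limsup_pinfty (fun a => (g a)%:E))%E.
Proof.
move=> g0; apply: le_ereal_inf_tmp => _ [M _ <-].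
apply: (@le_trans _ _ (g (M + 1))%:E); first by rewrite lee_fin.
by apply: ereal_sup_ubound; exists (M + 1) => //=; rewrite ltrDl.
Qed.

(** The threshold of the theorem is the squared radius of a ball of volume D / g, once delta is
    replaced by ln g / n. *)
Lemma sqrt_radius_exprn (R : realType) (n : nat) (g V D : R) : (0 < n)%N ->
  0 < g -> 0 < V -> 0 < D ->
  Num.sqrt (expR (- 2 * (ln g / n%:R)) * (D / V) `^ (2 / n%:R)) ^+ n = D / g / V.
Proof.
move=> n0 g0 V0 D0.
have n0' : n%:R != 0 :> R by rewrite pnatr_eq0 -lt0n.
have DV0 : 0 < D / V by rewrite divr_gt0.
rewrite -powR12_sqrt; last by rewrite mulr_ge0 ?expR_ge0 ?powR_ge0.
rewrite -powR_mulrn ?powR_ge0// -powRrM powRM ?expR_ge0 ?powR_ge0//.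
rewrite -powRrM (_ : 2 / n%:R * (2^-1 * n%:R) = 1); last by field.
rewrite (powRr1 (ltW DV0)) /powR gt_eqF ?expR_gt0// expRK.
rewrite (_ : 2^-1 * n%:R * (- 2 * (ln g / n%:R)) = - ln g); last by field.
rewrite expRN lnK ?posrE//; field.
by rewrite !gt_eqF.
Qed.

Theorem theorem4p2 (R : realType) (d : measure_display) (T : measurableType d)
  (P : probability T R) (n : nat) (sigma : R) (f : R -> R)
  (Hs Zs : 'I_n -> T -> R) (S : set 'rV[R]_n) (delta : R) :
  (0 < n)%N -> 0 < sigma ->
  regular_fading_pdf f ->
  (forall i, measurable_fun [set: T] (Hs i)) ->
  (forall i, measurable_fun [set: T] (Zs i)) ->
  (forall i (B : set R), measurable B ->
     P (Hs i @^-1` B) = (\int[lebesgue_measure]_(x in B) (f x)%:E)%E) ->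
  (forall i, P [set t | Hs i t < 0] = 0%E) ->
  (forall i, (\int[P]_t ((Hs i t) ^+ 2)%:E)%E = 1%E) ->
  (forall i (B : set R), measurable B -> P (Zs i @^-1` B) = normal_prob 0 sigma B) ->
  mutually_independent P (HZfamily Hs Zs) ->
  countable S -> is_NLD S delta ->
  (P ([set t | expR (- 2 * delta) * (\det (diag_mx (rvec Hs t)) / Vball R n) `^ (2 / n%:R)
              <= sqnorm (rvec Zs t)]%R)
   <= Pe P Hs Zs S)%E.
Proof.
move=> n0 sigma0 _ mH mZ lawH Hneg _ lawZ HZ cS [g [g0 [dS ->]]].
pose Rm := measurableTypeR R.
pose nu := prodm (normal_prob 0 sigma) n.
have nuE := law_Z_normal mZ lawZ HZ mH.
have [VE V0] := @lam_unit_ball R n n0.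
pose r (h : n.-tuple Rm) : R := expR (- 2 * (ln g / n%:R)) *
  ((\prod_(i < n) (tnth h i : R)) / Vball R n) `^ (2 / n%:R).
pose X : set (n.-tuple Rm * n.-tuple Rm) := [set p | r p.1 <= tsq p.2].
have mr : measurable_fun setT r.
  apply: measurable_funM => //; apply: (measurableT_comp (measurable_powR _)).
  apply: measurable_funM => //; apply: measurable_prod => i _.
  exact: (@measurable_tnth _ Rm n i).
have mX : measurable X.
  rewrite -[Y in measurable Y]setTI.
  apply: (measurable_fun_ler (f := r \o fst) (g := (@tsq R n) \o snd)) => //.
    exact: measurableT_comp.
  by apply: measurableT_comp => //; exact: measurable_tsq.
have DE t : \prod_(i < n) (tnth (tuple_of_rvs Hs t) i : R) = \det (diag_mx (rvec Hs t)).
  by rewrite det_diag; apply: eq_bigr => i _; rewrite tnth_mktuple mxE.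
have -> : [set t | expR (- 2 * (ln g / n%:R)) *
    (\det (diag_mx (rvec Hs t)) / Vball R n) `^ (2 / n%:R) <= sqnorm (rvec Zs t)] =
    [set t | X (tuple_of_rvs Hs t, tuple_of_rvs Zs t)].
  by apply/seteqP; split => t; rewrite /X/= /r DE -sqnorm_trow trow_tuple_of_rvs.
rewrite (joint_law mH mZ HZ nuE mX).
(* The fading is positive almost surely: negative values are excluded by hypothesis, and the value 0
   because the law has a density. *)
pose G := tuple_of_rvs Hs @^-1` box (fun=> `]0, +oo[%classic : set Rm).
have mG : measurable G.
  rewrite -[Y in measurable Y]setTI; apply: measurable_tuple_of_rvs => //.
  exact: measurable_box.
have PG : P (~` G) = 0%E.
  have Hpos i : P (Hs i @^-1` `]0, +oo[%classic) = 1%E.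
    have mHi (B : set R) : measurable B -> measurable (Hs i @^-1` B).
      by move=> mB; rewrite -[Y in measurable Y]setTI; exact: mH.
    have P0 : P (Hs i @^-1` [set 0]) = 0%E by rewrite lawH// integral_set1.
    have : (P (Hs i @^-1` `]-oo, 0%R]%classic) <= 0)%E.
      rewrite -[leRHS]adde0 -[X in (X + _)%E](Hneg i) -P0.
      have -> : Hs i @^-1` `]-oo, 0]%classic =
          [set t | Hs i t < 0] `|` Hs i @^-1` [set 0].
        apply/seteqP; split => t /=; rewrite in_itv/= le_eqVlt.
          by move=> /orP[/eqP ->|]; [right|left].
        by move=> [->|->]; rewrite ?orbT ?eqxx.
      apply: measureU2; last exact: mHi.
      rewrite (_ : [set t | _] = Hs i @^-1` `]-oo, 0[%classic); first exact: mHi.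
      by apply/seteqP; split => t /=; rewrite in_itv.
    have -> : Hs i @^-1` `]0, +oo[%classic = ~` (Hs i @^-1` `]-oo, 0]%classic).
      apply/seteqP; split => t /=; rewrite !in_itv/= andbT ltNge; first by move/negP.
      by move=> H; apply/negP.
    rewrite probability_setC; last exact: mHi.
    rewrite measure_le0 => /eqP ->; exact: sube0.
  rewrite probability_setC// /G (law_box_H mH mZ HZ)//.
  rewrite big1 ?subee// => i _; rewrite -[RHS]/(fine 1%E); congr fine; exact: Hpos.
have mF : measurable_fun [set: T] (fun t => nu (xsection X (tuple_of_rvs Hs t))).
  apply: (measurableT_comp (measurable_fun_xsection _ mX)).
  exact: measurable_tuple_of_rvs.
have F0 t : (0 <= nu (xsection X (tuple_of_rvs Hs t)))%E by exact: measure_ge0.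
(* Discarding the null event leaves an integrand that is 0 off [G], where nonnegativity of the
   limsup is enough. *)
rewrite (@ge0_negligible_integral _ _ _ P setT (~` G))//; last exact: measurableC.
rewrite setTD setCK integral_mkcond /Pe.
have L0 t : (0 <= limsup_pinfty (fun a => (avg_err P Zs S (rvec Hs t) a)%:E))%E.
  by apply: limsup_pinfty_ge0 => a; exact: avg_err_ge0.
apply: ge0_le_integralT => t; first by rewrite patchE; case: ifPn.
rewrite patchE; case: ifPn => [/set_mem Gt|_]; last exact: L0.
have h0 i : 0 < rvec Hs t 0 i.
  by have := Gt i; rewrite /= tnth_mktuple in_itv/= andbT mxE.
set D := \prod_i rvec Hs t 0 i.
have D0 : 0 < D by apply: prodr_gt0 => i _; exact: h0.
have rE : r (tuple_of_rvs Hs t) = expR (- 2 * (ln g / n%:R)) * (D / Vball R n) `^ (2 / n%:R).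
  by rewrite /r DE det_diag.
have r0 : 0 < r (tuple_of_rvs Hs t).
  by rewrite rE mulr_gt0 ?expR_gt0// powR_gt0// divr_gt0.
have volB : fine (prodm lebesgue_measure n (tball n (r (tuple_of_rvs Hs t)))) = D / g.
  by rewrite lam_tball// VE /= rE sqrt_radius_exprn// divfK// gt_eqF.
have := limsup_avg_err_ge n0 sigma0 cS nuE h0 g0 dS r0 volB.
(* The section of [X] at the current fading is the complement of the open ball, so the two
   probabilities are equal. *)
apply: le_trans; rewrite le_eqVlt; apply/orP; left; apply/eqP.
have mB : measurable (~` tball n (r (tuple_of_rvs Hs t))).
  by apply: measurableC; exact: measurable_tball.
rewrite -(nu_fin nuE mB); congr (prodm _ _ _).
apply/seteqP; split => v; rewrite /xsection/= ?inE /X /tball/= ?inE leNgt => /negP//.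
Qed.
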